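(* Let $d>0$ and let $\rho$ be a probability density on $[0,\infty)$ satisfying $\lim_{x\to 0^+} \rho(x)/(d x^{d-1}) = 1$. Let $c(v)$ be the matching cost of a vertex $v\in V_n$ in the stable matching of $K_{n,n}^\rho$, and let $W$ be a non-negative random variable with $\mathbb{P}(W\ge x)=\frac{1}{1+x}$ for $x\ge 0$. Then $n^{1/d}c(v)\to W^{1/d}$ in distribution as $n\to\infty$. Moreover, for any $0<p<d$, if in addition $\rho$ has finite $r$-th moment for some $r>2dp/(d-p)$, then as $n\to\infty$, $$ n^{p/d}\,\mathbb{E}[c(v)^p]\longrightarrow \mathbb{E}[W^{p/d}] = \frac{p\pi}{d\sin(p\pi/d)}.$$
   Context: $K_{n,n}^\rho$ is the complete bipartite graph with vertex sets $V_n,V_n'$, each of size $n$, whose edges $e=(v,v')$, $v\in V_n$, $v'\in V_n'$, carry i.i.d. non-negative costs $\omega(e)$ with density $\rho$. A matching is a set of pairwise non-adjacent edges. The matching cost $c(v)$ of a vertex is the cost of the edge of the matching incident to $v$ (and $\infty$ if $v$ is unmatched). A matching is stable if for every pair $v\in V_n$, $v'\in V_n'$, either $v$ and $v'$ are matched to each other or at least one of them has matching cost smaller than $\omega(v,v')$. Almost surely there is a unique stable matching; it is perfect and is obtained by the greedy algorithm which repeatedly adds the cheapest edge among those with both endpoints still unmatched. The law of $c(v)$ does not depend on $v$. The $r$-th moment of $\rho$ is $\int_0^\infty x^r\rho(x)\,dx$. *)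

(* Defs.v *)
From mathcomp Require Import all_boot all_order all_algebra.
From mathcomp Require Import all_classical all_reals all_analysis.

Set Implicit Arguments.
Unset Strict Implicit.
Unset Printing Implicit Defensive.

Import Order.TTheory GRing.Theory Num.Theory.
Import numFieldNormedType.Exports.

Local Open Scope classical_set_scope.
Local Open Scope ring_scope.

(* The two sides of the complete bipartite graph are V and V', so its edges
   are all the pairs (v, v') and a set of edges is a {set V * V'}. *)

Definition is_matching (V V' : finType) (M : {set V * V'}) : bool :=
  [forall e in M, forall f in M,
     (e != f) ==> (e.1 != f.1) && (e.2 != f.2)].

Definition matching_costl (R : realType) (V V' : finType) (w : V -> V' -> R)
    (M : {set V * V'}) (v : V) : \bar R :=
  if [pick v' | (v, v') \in M] is Some v' then (w v v')%:E else +oo%E.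

Definition matching_costr (R : realType) (V V' : finType) (w : V -> V' -> R)
    (M : {set V * V'}) (v' : V') : \bar R :=
  if [pick v | (v, v') \in M] is Some v then (w v v')%:E else +oo%E.

Definition is_stable_matching (R : realType) (V V' : finType)
    (w : V -> V' -> R) (M : {set V * V'}) : bool :=
  is_matching M &&
  [forall v, forall v',
     [|| (v, v') \in M,
         (matching_costl w M v < (w v v')%:E)%E
       | (matching_costr w M v' < (w v v')%:E)%E]].

(* For i.i.d. costs with a density there is almost surely exactly one stable
   matching, so neither the default value nor the choice made by [pick]
   matters outside an event of probability zero. *)
Definition stable_matching (R : realType) (V V' : finType)
    (w : V -> V' -> R) : {set V * V'} :=
  odflt finset.set0 [pick M | is_stable_matching w M].

Definition stable_cost (R : realType) (V V' : finType)
    (w : V -> V' -> R) (v : V) : \bar R :=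
  matching_costl w (stable_matching w) v.

(* Only the values of rho on [0, +oo[ are relevant. *)
Definition is_density (R : realType) (rho : R -> R) : Prop :=
  [/\ measurable_fun (`[0, +oo[ : set R) rho,
      (forall x : R, 0 <= x -> 0 <= rho x)
    & (\int[lebesgue_measure]_(x in `[0%R, +oo[) (rho x)%:E = 1)%E].

Definition has_density (R : realType) (disp : measure_display)
    (T : measurableType disp) (P : probability T R)
    (X : {RV P >-> R}) (rho : R -> R) : Prop :=
  forall A : set R, measurable A ->
    (distribution P X A =
     \int[lebesgue_measure]_(x in A `&` `[0%R, +oo[) (rho x)%:E)%E.

Definition mutually_independent (R : realType) (disp : measure_display)
    (T : measurableType disp) (P : probability T R) (I : finType)
    (X : I -> {RV P >-> R}) : Prop :=
  forall (J : {set I}) (A : I -> set R), (forall i, measurable (A i)) ->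
    (P (\bigcap_(i in [set` J]) (X i @^-1` A i)) =
     \prod_(i in J) P (X i @^-1` A i))%E.

(* The X n are allowed to live on different probability spaces and to take
   infinite values, as the cost of an unmatched vertex does. *)
Definition cvg_in_distribution (R : realType) (disp : nat -> measure_display)
    (T : forall n, measurableType (disp n)) (P : forall n, probability (T n) R)
    (X : forall n, T n -> \bar R)
    (disp' : measure_display) (T' : measurableType disp')
    (P' : probability T' R) (Y : T' -> R) : Prop :=
  let F := fun x : R => P' [set t | Y t <= x] in
  forall x : R, {for x, continuous F} ->
    P n [set t | (X n t <= x%:E)%E] @[n --> \oo] --> F x.

(* Main.v *)
Require Import Defs.
From mathcomp Require Import all_boot all_order all_algebra fingroup perm.
From mathcomp Require Import all_classical all_reals all_analysis.
From mathcomp Require Import measurable_realfun ring lra.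

(** Write [N] for the number of vertices on each side, [F] for the distribution
    function of the costs and [c] for the stable cost of a vertex. Everything
    rests on a bound valid for every [N] and [x] ([cost_tail_le] and
    [cost_tail_ge]):

      1 / (1 + N * F x / (1 - F x)) - 1 / N <= P (c > x) <= 1 / (1 + N * F x).

    The stable matching depends only on the order of the costs, which is uniform.
    Represent it by a uniformly random injective map [b] from the edges to [K]
    ranks, and let [U k] be the number of vertices of each side that are still
    free when the greedy algorithm has treated the ranks below [k]. The [U k ^ 2]
    edges between free vertices have ranks at least [k], all equally likely, so a
    match occurs at rank [k] with conditional probability [U k ^ 2 / (K - k)]
    ([sum_hit]). Hence the mean of [U k] decreases by the mean of [U k ^ 2] over
    [K - k], and Jensen's inequality gives [E (U k) <= N / (1 + N * k / K)]; on
    the other hand the mean of [1 / (U k + 1)] increases by at most [1 / (K - k)],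
    and Jensen's inequality for the inverse gives
    [E (U k) + 1 >= 1 / (1 / N + k / (K - k))]. No concentration estimate is
    needed. By symmetry a given vertex is free with probability [E (U k) / N].

    To pass to the actual costs, cut the line into [K] cells of probability
    [1 / K]. The cells of the costs are independent and uniform; they are distinct
    with probability at least [1 - N ^ 4 / K], and then they are ordered like the
    costs. The bound follows as [K] tends to infinity.

    Since [F x] is equivalent to [x ^ d] at 0, [N * F (z / N ^ (1 / d))] tends to
    [z ^ d], and both sides of the bound at [z / N ^ (1 / d)] tend to
    [1 / (1 + z ^ d)], which is the convergence in distribution.

    The rescaled moment is the integral over [u >= 0] of the rescaled tail at
    [u ^ (1 / p)], so dominated convergence applies once the rescaled tails are
    bounded uniformly by a multiple of [1 / (1 + z ^ q)] for some [q > p]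
    ([scaled_tail_dominated]). While the cost is below a constant [s0], the tail
    bound above suffices. Beyond, [P (c > x)] is at most [1 / (N * F s0)] and, by
    Markov's inequality for the edges at the vertex, at most a multiple of
    [N / x ^ r]; the geometric mean of these two bounds in which the powers of [N]
    cancel decays with the exponent [q = d * r / (2 * d + r)], and [q > p] is
    the hypothesis on [r].

    Finally the limit of the moments is the integral of [1 / (1 + u ^ b)] with
    [b = d / p]. Expanding in a geometric series on [0, 1] and on [1, +oo) turns it
    into the partial fraction series of the cosecant, whose sum is found from the
    positivity of the Fejer kernel ([cesaro_csc_sum], [integral_inv_powR]). *)

Set Implicit Arguments.
Unset Strict Implicit.
Unset Printing Implicit Defensive.

Import Order.TTheory GRing.Theory Num.Theory.
Import numFieldNormedType.Exports.

Local Open Scope classical_set_scope.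
Local Open Scope ring_scope.

(** * Stable matchings of a bipartite weighted graph *)

Section stable_matchings.
Context {R : realType} {V V' : finType}.
Implicit Types (w : V -> V' -> R) (e f : V * V') (M : {set V * V'}).

(** Two edges are adjacent when they share a vertex; an edge is adjacent to itself. *)
Definition adj e f := (e.1 == f.1) || (e.2 == f.2).

Lemma adjC e f : adj e f = adj f e.
Proof. by rewrite /adj eq_sym [e.2 == _]eq_sym. Qed.

Lemma matching_inj M e f : is_matching M -> e \in M -> f \in M ->
  adj e f -> e = f.
Proof.
move=> /forall_inP /(_ e) + eM => /(_ eM) /forall_inP /(_ f) + fM => /(_ fM) /implyP H.
apply: contraPeq => ef; apply/negP; rewrite negb_or; exact: H.
Qed.

Lemma costl_matched w M e : is_matching M -> e \in M ->
  matching_costl w M e.1 = (w e.1 e.2)%:E.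
Proof.
move=> mM eM; rewrite /matching_costl; case: pickP => [v' vM|/(_ e.2)].
  by have := matching_inj mM vM eM; rewrite /adj eqxx => /(_ isT) <-.
by rewrite -surjective_pairing eM.
Qed.

Lemma costr_matched w M e : is_matching M -> e \in M ->
  matching_costr w M e.2 = (w e.1 e.2)%:E.
Proof.
move=> mM eM; rewrite /matching_costr; case: pickP => [v vM|/(_ e.1)].
  by have := matching_inj mM vM eM; rewrite /adj eqxx orbT => /(_ isT) <-.
by rewrite -surjective_pairing eM.
Qed.

(** Stability without costs of vertices: every edge outside the matching is
    adjacent to a strictly cheaper edge of the matching. *)
Lemma stableP w M : reflect
  (is_matching M /\ forall e, e \notin M ->
     exists2 f, f \in M & adj f e && (w f.1 f.2 < w e.1 e.2))
  (is_stable_matching w M).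
Proof.
apply: (iffP andP) => -[mM sM]; split=> //.
  case=> v v' /= eM; move/forallP: sM => /(_ v)/forallP/(_ v').
  rewrite (negbTE eM) /=; case/orP.
    rewrite {1}/matching_costl; case: pickP => // u uM; rewrite lte_fin => lt.
    by exists (v, u); rewrite // /adj eqxx.
  rewrite {1}/matching_costr; case: pickP => // u uM; rewrite lte_fin => lt.
  by exists (u, v'); rewrite // /adj eqxx orbT.
apply/forallP => v; apply/forallP => v'; case: (boolP (_ \in M)) => //= /sM.
case=> -[u u'] fM /andP[/orP[]/eqP/= Eu]; subst.
  by move=> lt; have /= -> := costl_matched w mM fM; rewrite lte_fin lt.
by move=> lt; have /= -> := costr_matched w mM fM; rewrite lte_fin lt orbT.
Qed.

(** A stable matching solves the recursion of the greedy algorithm: an edge is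
    taken iff no cheaper adjacent edge is taken. *)
Lemma mem_stable w M e : is_stable_matching w M ->
  (e \in M) = ~~ [exists f, [&& f \in M, adj f e & w f.1 f.2 < w e.1 e.2]].
Proof.
move=> /stableP[mM sM]; apply/idP/idP => [eM|].
  apply/negP => /existsP[f /and3P[fM fe]].
  by rewrite (matching_inj mM fM eM fe) ltxx.
apply: contraR => /sM[f fM fe]; apply/existsP; exists f; by rewrite fM.
Qed.

(** By induction along the greedy recursion, stable matchings for two weights
    agree on every set of edges that is closed under taking cheaper edges and on
    which the weights induce the same order. This gives uniqueness, invariance
    under monotone changes of the weights, and the fact that the matching below a
    level does not depend on the edges above it. *)
Lemma stable_agree w w' M M' (S : pred (V * V')) :
  is_stable_matching w M -> is_stable_matching w' M' ->
  (forall e f, S e -> (w f.1 f.2 < w e.1 e.2) = (w' f.1 f.2 < w' e.1 e.2)) ->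
  (forall e f, S e -> w f.1 f.2 < w e.1 e.2 -> S f) ->
  forall e, S e -> (e \in M) = (e \in M').
Proof.
move=> sM sM' Hord Hdown e.
pose below e := #|[pred f | w f.1 f.2 < w e.1 e.2]|.
have [n] := ubnP (below e); elim: n e => // n IH e; rewrite ltnS => en Se.
(* Both sides refer only to the edges below [e], where the induction applies. *)
rewrite (mem_stable _ sM) (mem_stable _ sM'); congr (~~ _).
apply: eq_existsb => f; rewrite -Hord //.
case: (ltP (w f.1 f.2) _); rewrite ?andbT ?andbF // => fe.
congr (_ && _); apply: IH; last exact: Hdown fe.
apply: leq_trans en; apply: proper_card; apply/properP; split.
  by apply/fintype.subsetP => g; rewrite !inE => /lt_trans; apply.
by exists f; rewrite !inE // ltxx.
Qed.

(** Greedy construction: take the cheapest edge and discard its neighbours. *)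
Lemma stable_exists w : injective (fun e => w e.1 e.2) ->
  exists M, is_stable_matching w M.
Proof.
move=> wI.
suff H (S : {set V * V'}) : exists2 M : {set V * V'}, M \subset S &
    is_matching M /\ forall e, e \in S -> e \notin M ->
     exists2 f, f \in M & adj f e && (w f.1 f.2 < w e.1 e.2).
  have [M _ [mM sM]] := H [set: _]%SET; exists M; apply/stableP; split=> // e.
  by apply: sM; rewrite finset.in_setT.
have [n] := ubnP #|S|; elim: n S => // n IH S; rewrite ltnS => Sn.
have [->|[e0 e0S]] := set_0Vmem S.
  exists finset.set0; rewrite ?sub0set //; split; last by move=> e; rewrite finset.in_set0.
  by apply/forall_inP => e; rewrite finset.in_set0.
pose e := [arg min_(e < e0 in S) w e.1 e.2]%O.
have [eS emin] : e \in S /\ forall f, f \in S -> w e.1 e.2 <= w f.1 f.2.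
  by rewrite /e; case: arg_minP.
pose S' := [set f in S | ~~ adj e f]%SET.
have [|M MS [mM sM]] := IH S'.
  apply: leq_trans Sn; apply: proper_card; apply/properP; split.
    by apply/fintype.subsetP => f; rewrite inE => /andP[].
  by exists e; rewrite // inE /adj eqxx andbF.
have MS' f : f \in M -> (f \in S) && ~~ adj e f.
  by move=> /(fintype.subsetP MS); rewrite inE.
exists (e |: M)%SET.
  apply/fintype.subsetP => f; rewrite !inE => /orP[/eqP->//|/MS'/andP[]//].
split.
  apply/forall_inP => f; rewrite !inE => fM; apply/forall_inP => g.
  rewrite !inE => gM; apply/implyP => fg; rewrite -negb_or -/(adj f g).
  case/orP: fM gM fg => [/eqP->|fM] /orP[/eqP->|gM]; rewrite ?eqxx // => fg.
  - by have /andP[] := MS' _ gM.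
  - by rewrite adjC; have /andP[] := MS' _ fM.
  - by apply: contra fg => /(matching_inj mM fM gM)/eqP.
move=> f fS; rewrite !inE negb_or => /andP[fe fM].
case: (boolP (adj e f)) => ef.
  exists e; rewrite ?inE ?eqxx // ef /= lt_neqAle emin // andbT.
  by apply: contra fe => /eqP /wI ->.
have [|g gM gf] := sM f _ fM; first by rewrite inE fS.
by exists g; rewrite // !inE gM orbT.
Qed.

Lemma stable_matchingP w : injective (fun e => w e.1 e.2) ->
  is_stable_matching w (stable_matching w).
Proof.
move=> /stable_exists[M sM]; rewrite /stable_matching.
by case: pickP => //= /(_ M); rewrite sM.
Qed.

Lemma stable_unique w M : injective (fun e => w e.1 e.2) ->
  is_stable_matching w M -> M = stable_matching w.
Proof.
move=> /stable_matchingP sw sM; apply/setP => e.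
exact: (stable_agree (S := predT) sM sw).
Qed.

End stable_matchings.

(** * Greedy matching along a random order of the edges *)

Section random_order.
Context (R : realType) (V : finType) (K : nat).
Implicit Types (b : {ffun V * V -> 'I_K}) (e f : V * V) (k : nat).

(** The weights given by the ranks of the edges; an injective [b] represents a
    total order of the edges, spread over [K] positions. *)
Definition rank_weight b : V -> V -> R := fun v v' => (b (v, v') : nat)%:R.
(** The stable matching of the ranks. *)
Definition rank_matching b := stable_matching (rank_weight b).
(** The left vertex [v] is matched by an edge of rank below [k]. *)
Definition used_l k b v := [exists e in rank_matching b, (e.1 == v) && (b e < k)%N].
(** The right vertex [v] is matched by an edge of rank below [k]. *)
Definition used_r k b v := [exists e in rank_matching b, (e.2 == v) && (b e < k)%N].
(** The number of matched edges of rank below [k]. *)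
Definition n_used k b := #|[set e in rank_matching b | (b e < k)%N]%SET|.
(** The number of matched edges of rank exactly [k], which is 0 or 1. *)
Definition hit k b := #|[set e in rank_matching b | b e == k :> nat]%SET|.

Lemma rank_weightE b e : rank_weight b e.1 e.2 = (b e : nat)%:R.
Proof. by rewrite /rank_weight -surjective_pairing. Qed.

Lemma rank_matching_stable b : injective b ->
  is_stable_matching (rank_weight b) (rank_matching b).
Proof.
move=> bI; apply: stable_matchingP => e f; rewrite !rank_weightE => /eqP.
by rewrite eqr_nat => /eqP/val_inj/bI.
Qed.

Lemma is_matching_rank_matching b : injective b -> is_matching (rank_matching b).
Proof. by move/rank_matching_stable/stableP => []. Qed.

Lemma mem_rank_matching b e : injective b ->
  (e \in rank_matching b) = ~~ used_l (b e) b e.1 && ~~ used_r (b e) b e.2.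
Proof.
move=> bI; rewrite (mem_stable _ (rank_matching_stable bI)) -negb_or; congr (~~ _).
rewrite !rank_weightE; apply/existsP/orP => [[f /and3P[fM]]|].
  rewrite rank_weightE ltr_nat => /orP[] fe lt; [left|right];
  by apply/exists_inP; exists f; rewrite // fe.
by case=> /exists_inP[f fM /andP[fe lt]]; exists f;
  rewrite fM rank_weightE ltr_nat lt /adj fe ?orbT.
Qed.

Lemma used_l_mono k l b v : (k <= l)%N -> used_l k b v -> used_l l b v.
Proof.
move=> kl /exists_inP[f fM /andP[fe lt]]; apply/exists_inP; exists f => //.
by rewrite fe (leq_trans lt).
Qed.

Lemma used_r_mono k l b v : (k <= l)%N -> used_r k b v -> used_r l b v.
Proof.
move=> kl /exists_inP[f fM /andP[fe lt]]; apply/exists_inP; exists f => //.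
by rewrite fe (leq_trans lt).
Qed.

(** An edge between two vertices that are free at time [k] has not been
    reached at time [k], for it would have been taken. *)
Lemma free_rank_ge b k e : injective b -> ~~ used_l k b e.1 -> ~~ used_r k b e.2 ->
  (k <= b e)%N.
Proof.
move=> bI ul ur; rewrite leqNgt; apply/negP => lt.
have : e \in rank_matching b.
  rewrite mem_rank_matching // (contra (used_l_mono (ltnW lt)) ul).
  by rewrite (contra (used_r_mono (ltnW lt)) ur).
by move=> eM; case/negP: ul; apply/exists_inP; exists e; rewrite // eqxx.
Qed.

Lemma card_used_l k b : injective b -> #|[set v | used_l k b v]%SET| = n_used k b.
Proof.
move=> bI; rewrite /n_used -(card_in_imset (f := fst)); last first.
  move=> e f; rewrite !inE => /andP[eM _] /andP[fM _] ef.
  by apply: (matching_inj (is_matching_rank_matching bI)) => //; rewrite /adj ef eqxx.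
apply: eq_card => v; rewrite inE; apply/exists_inP/imsetP => [[e eM /andP[/eqP ev lt]]|].
  by exists e; rewrite ?inE ?eM.
by case=> e; rewrite inE => /andP[eM lt] ->; exists e; rewrite // eqxx.
Qed.

Lemma card_used_r k b : injective b -> #|[set v | used_r k b v]%SET| = n_used k b.
Proof.
move=> bI; rewrite /n_used -(card_in_imset (f := snd)); last first.
  move=> e f; rewrite !inE => /andP[eM _] /andP[fM _] ef.
  by apply: (matching_inj (is_matching_rank_matching bI)) => //; rewrite /adj ef eqxx orbT.
apply: eq_card => v; rewrite inE; apply/exists_inP/imsetP => [[e eM /andP[/eqP ev lt]]|].
  by exists e; rewrite ?inE ?eM.
by case=> e; rewrite inE => /andP[eM lt] ->; exists e; rewrite // eqxx.
Qed.

Lemma card_free k b : injective b ->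
  #|[set e | ~~ used_l k b e.1 && ~~ used_r k b e.2]%SET| = ((#|V| - n_used k b) ^ 2)%N.
Proof.
move=> bI; transitivity #|finset.setX (~: [set v | used_l k b v]) (~: [set v | used_r k b v])|.
  by apply: eq_card => e; rewrite !inE.
have cardC (A : {set V}) : #|~: A|%SET = (#|V| - #|A|)%N.
  by rewrite cardsCs finset.setCK.
by rewrite cardsX !cardC card_used_l // card_used_r // -mulnn.
Qed.

Lemma n_used_le k b : injective b -> (n_used k b <= #|V|)%N.
Proof. by move=> bI; rewrite -card_used_l // max_card. Qed.

(** The matching is perfect: a free vertex on the left forces a free vertex on
    the right, and the edge between them would have been taken. *)
Lemma used_l_total b v : injective b -> used_l K b v.
Proof.
move=> bI; apply: contraT => ul.
case: (boolP [forall v', used_r K b v']) => [/forallP ur|/forallPn[v' ur]]; last first.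
  by have := free_rank_ge (e := (v, v')) bI ul ur; rewrite leqNgt ltn_ord.
have : (#|[set v' | used_l K b v']%SET| < #|[set: V]%SET|)%N.
  apply: proper_card; apply/properP; split; first exact: finset.subsetT.
  by exists v; rewrite ?finset.in_setT // inE.
rewrite card_used_l // -(card_used_r K bI) (_ : [set v' | _]%SET = [set: V]%SET) ?ltnn //.
by apply/setP => v'; rewrite finset.in_setT inE ur.
Qed.

Lemma n_usedS k b : n_used k.+1 b = (n_used k b + hit k b)%N.
Proof.
rewrite /n_used /hit -cardsUI [X in (_ + X)%N](_ : _ = 0%N) ?addn0.
  by apply: eq_card => e; rewrite !inE -andb_orr ltnS leq_eqVlt orbC.
apply/eqP; rewrite cards_eq0; apply/eqP/setP => e; rewrite !inE.
by case: ltngtP; rewrite ?andbF.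
Qed.

Lemma hit_le1 k b : injective b -> (hit k b <= 1)%N.
Proof.
move=> bI; apply/card_le1_eqP => e f; rewrite !inE => /andP[_ /eqP ek] /andP[_ /eqP fk].
by apply/bI/val_inj; rewrite /= ek.
Qed.

Lemma n_used0 b : n_used 0 b = 0%N.
Proof. by apply/eqP; rewrite cards_eq0; apply/eqP/setP => e; rewrite !inE andbF. Qed.

Section agree.
Variables (k : nat) (b b' : {ffun V * V -> 'I_K}).
Hypotheses (bI : injective b) (b'I : injective b').
Hypothesis bb' : forall e, (b e < k)%N || (b' e < k)%N -> b e = b' e.

Lemma agree_lt e : (b e < k)%N = (b' e < k)%N.
Proof. by apply/idP/idP => H; move: (H); rewrite (bb' (e:=e)) // H ?orbT. Qed.

Lemma rank_matching_agree e : (b e < k)%N -> (e \in rank_matching b) = (e \in rank_matching b').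
Proof.
move=> ek; apply: (stable_agree (S := fun e => (b e < k)%N)
  (rank_matching_stable bI) (rank_matching_stable b'I)) => //.
  move=> {ek}e f ek; rewrite !rank_weightE !ltr_nat -(bb' (e := e)) ?ek //.
  have [fk|] := ltnP (b f) k; first by rewrite -(bb' (e := f)) ?fk.
  move=> fk; move: (fk); rewrite leqNgt agree_lt -leqNgt => fk'.
  by rewrite !ltnNge !(leq_trans (ltnW ek)).
by move=> {ek}e f ek; rewrite !rank_weightE ltr_nat => /ltn_trans; apply.
Qed.

Lemma rank_matching_lt_agree e :
  (e \in rank_matching b) && (b e < k)%N = (e \in rank_matching b') && (b' e < k)%N.
Proof. by rewrite -agree_lt; case: ltnP => [/rank_matching_agree->//|]; rewrite !andbF. Qed.

Lemma n_used_agree : n_used k b = n_used k b'.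
Proof. by apply: eq_card => e; rewrite !inE rank_matching_lt_agree. Qed.

Lemma used_l_agree v : used_l k b v = used_l k b' v.
Proof. by apply: eq_existsb => e; rewrite andbCA rank_matching_lt_agree andbCA. Qed.

Lemma used_r_agree v : used_r k b v = used_r k b' v.
Proof. by apply: eq_existsb => e; rewrite andbCA rank_matching_lt_agree andbCA. Qed.

End agree.

(** Exchange the ranks [j] and [k]. *)
Definition swap_rank (j k : 'I_K) b : {ffun V * V -> 'I_K} := [ffun e => tperm j k (b e)].

Lemma swap_rankK (j k : 'I_K) : involutive (swap_rank j k).
Proof. by move=> b; apply/ffunP => e; rewrite !ffunE tpermK. Qed.

Lemma swap_rank_inj (j k : 'I_K) b : injective (swap_rank j k b) <-> injective b.
Proof.
have H (c : {ffun V * V -> 'I_K}) : injective c -> injective (swap_rank j k c).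
  by move=> cI e f; rewrite !ffunE => /perm_inj/cI.
by split=> [/H|/H//]; rewrite swap_rankK.
Qed.

Lemma swap_rank_agree (j k : 'I_K) m b e : (m <= j)%N -> (m <= k)%N ->
  (b e < m)%N || (swap_rank j k b e < m)%N -> b e = swap_rank j k b e.
Proof.
move=> mj mk; rewrite ffunE; case: tpermP => // ->.
  by rewrite !ltnNge mj mk.
by rewrite !ltnNge mj mk.
Qed.

(** Tested against any function [h] of the past, the probability of a match at
    time [k] is the number of edges between free vertices divided by [K - k].
    Indeed such an edge has some rank [j >= k], and exchanging the ranks [j] and
    [k] does not affect what happens before time [k], so that all these ranks are
    equally likely. *)
Lemma sum_hit (k : 'I_K) (h : nat -> R) :
  \sum_(b : {ffun V * V -> 'I_K} | injectiveb b) h (n_used k b) * ((#|V| - n_used k b) ^ 2)%:R =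
  (K - k)%:R * \sum_(b : {ffun V * V -> 'I_K} | injectiveb b) h (n_used k b) * (hit k b)%:R.
Proof.
pose free b e := ~~ used_l k b e.1 && ~~ used_r k b e.2.
transitivity (\sum_e \sum_(j : 'I_K | (k <= j)%N)
    \sum_(b : {ffun V * V -> 'I_K} | injectiveb b) h (n_used k b) * (free b e && (b e == j))%:R).
  symmetry; under eq_bigr => e _ do rewrite exchange_big.
  rewrite exchange_big; apply: eq_bigr => b /injectiveP bI; symmetry.
  rewrite -card_free // -sum1_card big_mkcond natr_sum mulr_sumr.
  apply: eq_bigr => e _; rewrite inE -/(free b e).
  case: (boolP (free b e)) => /= [fe|fe]; last by rewrite mulr0 big1 // => j _; rewrite mulr0.
  rewrite (bigD1 (b e)) ?eqxx /=; last by case/andP: fe; exact: free_rank_ge.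
  by rewrite big1 ?addr0 // => j /andP[_ /negbTE]; rewrite eq_sym => ->; rewrite mulr0.
(* The rank [j] of a free edge may be replaced by [k]. *)
have swapE e (j : 'I_K) : (k <= j)%N ->
    \sum_(b : {ffun V * V -> 'I_K} | injectiveb b) h (n_used k b) * (free b e && (b e == j))%:R =
    \sum_(b : {ffun V * V -> 'I_K} | injectiveb b) h (n_used k b) * (free b e && (b e == k))%:R.
  move=> kj; rewrite (reindex_inj (can_inj (swap_rankK k j))).
  apply: eq_big => [b|b /injectiveP sI].
    by apply/injectiveP/injectiveP => /swap_rank_inj.
  have bI := (swap_rank_inj k j b).1 sI.
  have A f := @swap_rank_agree k j k b f (leqnn _) kj.
  rewrite /free -(used_l_agree bI sI A) -(used_r_agree bI sI A) -(n_used_agree bI sI A).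
  by rewrite ffunE -(inj_eq (@perm_inj _ (tperm k j))) tpermK tpermR.
under eq_bigr => e _ do under eq_bigr => j kj do rewrite swapE //.
under eq_bigr => e _ do rewrite sumr_const.
have -> : #|[pred j : 'I_K | (k <= j)%N]| = (K - k)%N.
  rewrite -sum1_card -(big_mkord (fun j => (k <= j)%N) (fun=> 1%N)).
  rewrite (eq_bigl (fun j => true && (k <= j)%N)) //.
  by rewrite -(@big_nat_widenl _ _ _ k 0 K xpredT) // sum_nat_const_nat muln1.
under eq_bigr => e _ do rewrite -mulr_natl.
rewrite -mulr_sumr exchange_big; congr (_ * _); apply: eq_bigr => b /injectiveP bI.
rewrite -mulr_sumr; congr (_ * _); rewrite -natr_sum /hit -sum1_card.
rewrite [in RHS]big_mkcond; congr (_%:R); apply: eq_bigr => e _; rewrite !inE.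
rewrite -(inj_eq val_inj) /=; case: (b e =P k :> nat) => be; rewrite ?andbF //.
by rewrite mem_rank_matching // be andbT /free; case: ifP.
Qed.

End random_order.

(** * Exchangeability of the vertices *)

Section exchangeable.
Context (R : realType) (V : finType) (K : nat).
Implicit Types (b : {ffun V * V -> 'I_K}).

(** Permute the left vertices by [s]. *)
Definition relabel (s : {perm V}) b : {ffun V * V -> 'I_K} :=
  [ffun e => b (s e.1, e.2)].

Lemma relabelK s : cancel (relabel s) (relabel s^-1).
Proof. by move=> b; apply/ffunP => -[v v']; rewrite !ffunE /= permKV. Qed.

Lemma relabel_inj s b : injective b -> injective (relabel s b).
Proof. by move=> bI [v v'] [u u']; rewrite !ffunE /= => /bI[/perm_inj-> ->]. Qed.

Lemma rank_matching_relabel s b : injective b ->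
  rank_matching R (relabel s b) = [set e | (s e.1, e.2) \in rank_matching R b]%SET.
Proof.
move=> bI; apply/esym/stable_unique.
  move=> e f; rewrite !rank_weightE => /eqP.
  by rewrite eqr_nat => /eqP/val_inj/(relabel_inj (s := s) bI).
have [mM sM] := stableP _ _ (rank_matching_stable R bI).
apply/stableP; split.
  apply/forall_inP => e; rewrite inE => eM; apply/forall_inP => f.
  rewrite inE => fM; apply/implyP; rewrite -negb_or; apply: contra => ef.
  have : (s e.1, e.2) = (s f.1, f.2).
    apply: (matching_inj mM eM fM); case/orP: ef => /eqP ef;
    by rewrite /adj /= ef eqxx ?orbT.
  by case=> /perm_inj e1 e2; apply/eqP; case: (e) (f) e1 e2 => [? ?] [? ?] /= -> ->.
move=> e; rewrite inE => /sM[f fM /andP[fe]]; rewrite !rank_weightE => lt.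
exists ((s^-1)%g f.1, f.2); first by rewrite inE /= permKV -surjective_pairing.
rewrite !rank_weightE !ffunE /= permKV -surjective_pairing lt andbT.
by move: fe; rewrite /adj /= => /orP[] /eqP ->; rewrite ?permK eqxx ?orbT.
Qed.

Lemma used_l_relabel s b k v : injective b ->
  used_l R k (relabel s b) v = used_l R k b (s v).
Proof.
move=> bI; apply/exists_inP/exists_inP => -[e].
  rewrite rank_matching_relabel // inE => eM /andP[/eqP ev lt]; exists (s e.1, e.2) => //.
  by move: lt; rewrite ffunE /= ev eqxx.
move=> eM /andP[/eqP ev lt]; exists ((s^-1)%g e.1, e.2).
  by rewrite rank_matching_relabel // inE /= permKV -surjective_pairing.
by rewrite ffunE /= permKV -surjective_pairing lt ev permK eqxx.
Qed.

(** All left vertices have the same probability of being free. *)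
Lemma sum_free_l k v :
  #|V|%:R * \sum_(b : {ffun V * V -> 'I_K} | injectiveb b) (~~ used_l R k b v)%:R =
  \sum_(b : {ffun V * V -> 'I_K} | injectiveb b) (#|V| - n_used R k b)%:R :> R.
Proof.
transitivity (\sum_(v' : V) \sum_(b : {ffun V * V -> 'I_K} | injectiveb b)
    (~~ used_l R k b v')%:R : R).
  rewrite mulr_natl -sumr_const; apply: eq_bigr => v' _.
  rewrite [RHS](reindex_inj (can_inj (relabelK (tperm v v')))).
  apply: eq_big => [b|b /injectiveP bI].
    apply/injectiveP/injectiveP => [|/(relabel_inj (s := (tperm v v')^-1)%g)].
      exact: relabel_inj.
    by rewrite relabelK.
  by rewrite used_l_relabel // tpermR.
rewrite exchange_big; apply: eq_bigr => b /injectiveP bI.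
rewrite -(card_used_l R k bI) -natr_sum; congr (_%:R).
rewrite -(cardsC [set v | used_l R k b v]%SET) addKn -sum1_card [RHS]big_mkcond.
by apply: eq_bigr => v' _; rewrite !inE; case: used_l.
Qed.

End exchangeable.

(** * The probability that a vertex is still free *)

Section free_vertex_bounds.
Context (R : realType) (V : finType) (K : nat).
Implicit Types (b : {ffun V * V -> 'I_K}) (k : nat) (g h : {ffun V * V -> 'I_K} -> R).

(** The expectation of [g] under a uniformly random order. *)
Definition inj_avg g := (\sum_(b : {ffun V * V -> 'I_K} | injectiveb b) g b) /
  #|[pred b : {ffun V * V -> 'I_K} | injectiveb b]|%:R.

Hypothesis inj_gt0 : (0 < #|[pred b : {ffun V * V -> 'I_K} | injectiveb b]|)%N.

Lemma inj_avgD g h : inj_avg (fun b => g b + h b) = inj_avg g + inj_avg h.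
Proof. by rewrite /inj_avg big_split mulrDl. Qed.

Lemma inj_avgZ a g : inj_avg (fun b => a * g b) = a * inj_avg g.
Proof. by rewrite /inj_avg -mulr_sumr mulrA. Qed.

Lemma inj_avg_cst a : inj_avg (fun=> a) = a.
Proof.
rewrite /inj_avg sumr_const -[a *+ _]mulr_natr mulfK // pnatr_eq0 -lt0n; exact: inj_gt0.
Qed.

Lemma ler_inj_avg g h : (forall b, injective b -> g b <= h b) -> inj_avg g <= inj_avg h.
Proof.
move=> gh; rewrite ler_wpM2r ?invr_ge0 //; apply: ler_sum => b /injectiveP; exact: gh.
Qed.

Lemma eq_inj_avg g h : (forall b, injective b -> g b = h b) -> inj_avg g = inj_avg h.
Proof. by move=> gh; congr (_ / _); apply: eq_bigr => b /injectiveP; exact: gh. Qed.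

(** Jensen's inequality for the square. *)
Lemma inj_avg_sqr g : inj_avg g ^+ 2 <= inj_avg (fun b => g b ^+ 2).
Proof.
set m := inj_avg g.
have : 0 <= inj_avg (fun b => (g b - m) ^+ 2).
  by rewrite -[X in X <= _](inj_avg_cst 0); apply: ler_inj_avg => b _; exact: sqr_ge0.
rewrite (_ : (fun b => (g b - m) ^+ 2) =
    (fun b => g b ^+ 2 + ((- (2 * m)) * g b + m ^+ 2))); last first.
  by apply/funext => b; ring.
by rewrite !inj_avgD inj_avgZ inj_avg_cst -/m; lra.
Qed.

(** Jensen's inequality for the inverse, from its tangent line at the mean. *)
Lemma inj_avg_inv g : (forall b, injective b -> 0 < g b) -> 0 < inj_avg g ->
  (inj_avg g)^-1 <= inj_avg (fun b => (g b)^-1).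
Proof.
move=> g0 m0; set m := inj_avg g in m0 *.
have -> : m^-1 = inj_avg (fun b => 2 / m + (- m ^- 2) * g b).
  rewrite inj_avgD (inj_avgZ _ g) inj_avg_cst -/m.
  by move: m0; set x := m => m0; field; lra.
apply: ler_inj_avg => b /g0 gb; rewrite -subr_ge0.
suff -> : (g b)^-1 - (2 / m + - m ^- 2 * g b) = (g b - m) ^+ 2 / (g b * m ^+ 2).
  by rewrite divr_ge0 ?sqr_ge0 // mulr_ge0 ?sqr_ge0 // ltW.
by field; rewrite !lt0r_neq0.
Qed.

Let U k b : R := (#|V| - n_used R k b)%:R.

Lemma n_freeS k b : injective b -> U k.+1 b = U k b - (hit R k b)%:R.
Proof.
move=> bI; rewrite /U n_usedS subnDA natrB // leq_subRL ?n_used_le //.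
by rewrite -n_usedS n_used_le.
Qed.

Lemma inj_avg_hit (k : 'I_K) (h : nat -> R) :
  inj_avg (fun b => h (n_used R k b) * U k b ^+ 2) =
  (K - k)%:R * inj_avg (fun b => h (n_used R k b) * (hit R k b)%:R).
Proof.
rewrite /inj_avg mulrA -sum_hit; congr (_ / _); apply: eq_bigr => b _.
by rewrite /U natrX.
Qed.

Lemma inj_avg_freeS (k : 'I_K) :
  inj_avg (U k.+1) = inj_avg (U k) - inj_avg (fun b => U k b ^+ 2) / (K - k)%:R.
Proof.
have := inj_avg_hit k (fun=> 1).
under [X in X = _]eq_inj_avg do rewrite mul1r.
under [X in _ = _ * X]eq_inj_avg do rewrite mul1r.
move=> ->; rewrite mulrC mulKf; last by rewrite pnatr_eq0 subn_eq0 -ltnNge.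
rewrite -mulN1r -inj_avgZ -inj_avgD; apply: eq_inj_avg => b bI.
by rewrite n_freeS // mulN1r.
Qed.

Lemma inj_avg_free_ge0 k : 0 <= inj_avg (U k).
Proof. by rewrite -[X in X <= _](inj_avg_cst 0); apply: ler_inj_avg. Qed.

(** Let [Q k] be the mean number of free vertices. By [sum_hit] and Jensen's
    inequality [Q k.+1 <= Q k - Q k ^ 2 / K], hence the inverse of [Q k] increases
    by at least [1 / K] at each step. *)
Lemma inj_avg_free_le k : (k <= K)%N ->
  inj_avg (U k) * (1 + #|V|%:R * k%:R / K%:R) <= #|V|%:R.
Proof.
elim: k => [_|k IH kK].
  rewrite mulr0 mul0r addr0 mulr1 (_ : U 0 = fun=> #|V|%:R) ?inj_avg_cst //.
  by apply/funext => b; rewrite /U n_used0 subn0.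
have K0 : 0 < K%:R :> R by rewrite ltr0n (leq_ltn_trans _ kK).
move: (IH (ltnW kK)) (inj_avg_free_ge0 k) (inj_avg_free_ge0 k.+1).
have := inj_avg_freeS (Ordinal kK) => /=.
have := inj_avg_sqr (U k); set m2 := inj_avg (fun b => U k b ^+ 2).
set Q := inj_avg (U k); set Q' := inj_avg (U k.+1) => m2Q Q'E HQ Q0 Q'0.
(* Weaken [K - k] to [K]. *)
have Q'Q : Q' <= Q - Q ^+ 2 / K%:R.
  rewrite Q'E lerB // ler_pM ?sqr_ge0 ?invr_ge0 //.
  by rewrite lef_pV2 ?posrE // ?ltr0n ?subn_gt0 // ler_nat leq_subr.
have : Q' * (1 + Q / K%:R) <= Q.
  apply: (@le_trans _ _ ((Q - Q ^+ 2 / K%:R) * (1 + Q / K%:R))).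
    by rewrite ler_wpM2r // addr_ge0 // divr_ge0.
  rewrite (_ : _ * _ = Q - Q * (Q / K%:R) ^+ 2); last by field; lra.
  by rewrite lerBlDr lerDl mulr_ge0 // sqr_ge0.
have N0 : 0 <= #|V|%:R :> R by [].
move: HQ; rewrite -natr1; move: Q'Q; set x := K%:R in K0 *; set n := #|V|%:R in N0 *.
have [->|Qn0] := eqVneq Q 0.
  rewrite expr0n /= mul0r subr0 => Q'l _ _.
  have -> : Q' = 0 by apply/eqP; rewrite eq_le Q'l.
  by rewrite mul0r.
have Qp : 0 < Q by rewrite lt_neqAle eq_sym Qn0.
move=> _ HQ H; rewrite -(ler_pM2l Qp).
apply: (@le_trans _ _ (n * (Q' * (1 + Q / x)))); last by rewrite mulrC ler_wpM2r.
rewrite [leLHS](_ : _ = Q' * (Q * (1 + n * k%:R / x) + Q * n / x)); last by field; lra.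
rewrite [leRHS](_ : _ = Q' * (n + Q * n / x)); last by field; lra.
by rewrite ler_wpM2l // lerD2r.
Qed.

(** When the number [u] of free vertices drops by one, [1 / (u + 1)] increases
    by [1 / (u * (u + 1))], and this happens with probability [u ^ 2 / (K - j)].
    So at step [j] its mean increases by at most [1 / (K - j)], which is at most
    [1 / (K - k)]. *)
Lemma inj_avg_inv_free_le k : (k < K)%N ->
  inj_avg (fun b => (U k b + 1)^-1) <= (#|V|%:R + 1)^-1 + k%:R / (K - k)%:R.
Proof.
move=> kK.
suff H j : (j <= k)%N -> inj_avg (fun b => (U j b + 1)^-1) <=
    (#|V|%:R + 1)^-1 + j%:R / (K - k)%:R by exact: H.
elim: j => [_|j IH jk].
  rewrite mul0r addr0 -[X in _ <= X]inj_avg_cst; apply: ler_inj_avg => b _.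
  by rewrite /U n_used0 subn0.
have jK : (j < K)%N by apply: ltn_trans kK.
pose h m : R := ((#|V| - m)%:R * ((#|V| - m)%:R + 1))^-1.
(* The weight [h] is the increase of the inverse when a match occurs. *)
have stepE b : injective b -> (U j.+1 b + 1)^-1 =
    (U j b + 1)^-1 + h (n_used R j b) * (hit R j b)%:R.
  move=> bI; rewrite n_freeS // /h -/(U j b).
  have : (hit R j b)%:R <= U j b by rewrite -subr_ge0 -n_freeS.
  have := hit_le1 R j bI; case: (hit R j b) => [|[|//]] _.
    by rewrite subr0 mulr0 addr0.
  by move=> u1; field; apply/andP; split; lra.
have Kj : 0 < (K - j)%:R :> R by rewrite ltr0n subn_gt0.
rewrite (eq_inj_avg stepE) inj_avgD -natr1 mulrDl mul1r addrA.
apply: lerD; first exact: IH (ltnW jk).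
have := inj_avg_hit (Ordinal jK) h => /= /(congr1 (fun z => z / (K - j)%:R)).
rewrite [_ * inj_avg _]mulrC mulfK ?lt0r_neq0 // => <-.
apply: (@le_trans _ _ (1 / (K - j)%:R)); last first.
  rewrite mul1r lef_pV2 ?posrE // ?ltr0n ?subn_gt0 // ler_nat leq_sub2l //.
  exact: ltnW.
rewrite ler_wpM2r ?invr_ge0 // -[X in _ <= X]inj_avg_cst.
apply: ler_inj_avg => b bI; rewrite /h -/(U j b).
have : 0 <= U j b by [].
rewrite le_eqVlt => /predU1P[<-|u0]; first by rewrite expr0n mulr0.
rewrite (_ : _ * _ = U j b / (U j b + 1)); last by field; apply/andP; split; lra.
by rewrite ler_pdivrMr; lra.
Qed.

Hypothesis V_gt0 : (0 < #|V|)%N.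

Lemma inj_avg_free_l k v :
  inj_avg (fun b => (~~ used_l R k b v)%:R) = inj_avg (U k) / #|V|%:R.
Proof.
rewrite /inj_avg -(sum_free_l R K k v) mulrAC [X in _ = X * _]mulrAC mulfV ?mul1r //.
by rewrite pnatr_eq0 -lt0n.
Qed.

Lemma free_prob_le k v : (k <= K)%N ->
  inj_avg (fun b => (~~ used_l R k b v)%:R) <= (1 + #|V|%:R * (k%:R / K%:R))^-1.
Proof.
move=> kK; rewrite inj_avg_free_l ler_pdivrMr ?ltr0n // -mulrC ler_pdivlMr.
  by rewrite mulrA; exact: inj_avg_free_le.
by rewrite ltr_pwDl // mulr_ge0 // divr_ge0.
Qed.

Lemma free_prob_ge k v : (k < K)%N ->
  (1 + #|V|%:R * (k%:R / (K - k)%:R))^-1 - #|V|%:R^-1 <=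
  inj_avg (fun b => (~~ used_l R k b v)%:R).
Proof.
move=> kK; rewrite inj_avg_free_l.
have Kk : 0 < (K - k)%:R :> R by rewrite ltr0n subn_gt0.
have n0 : 0 < #|V|%:R :> R by rewrite ltr0n.
have m0 : 0 < inj_avg (fun b => U k b + 1).
  by rewrite inj_avgD inj_avg_cst ltr_wpDl // inj_avg_free_ge0.
have := inj_avg_inv (g := fun b => U k b + 1) _ m0.
move=> /(_ (fun b _ => ltr_wpDl (ler0n _ _) ltr01)).
move=> /le_trans/(_ (inj_avg_inv_free_le kK)).
move: m0; rewrite inj_avgD inj_avg_cst; set Q := inj_avg _ => m0.
set x := k%:R / _; have x0 : 0 <= x by rewrite divr_ge0.
set n := #|V|%:R in n0 *.
move=> H; have {}H : (Q + 1)^-1 <= n^-1 + x.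
  by apply: le_trans H _; rewrite lerD2r lef_pV2 ?posrE; lra.
have nx : 0 < n^-1 + x by rewrite ltr_pwDl // invr_gt0.
have {}H : (n^-1 + x)^-1 <= Q + 1.
  by rewrite -[leRHS]invrK lef_pV2 ?posrE ?invr_gt0.
rewrite (_ : 1 + n * x = n * (n^-1 + x)); last by field; rewrite lt0r_neq0.
move: (n^-1 + x) nx H => y y0 H.
rewrite (_ : _ - _ = (y^-1 - 1) / n); last by field; rewrite !lt0r_neq0.
by rewrite ler_pM2r ?invr_gt0 // lerBlDr.
Qed.

End free_vertex_bounds.

(** * Measurability of the stable cost *)

Section measurability.
Context d (T : measurableType d) (R : realType).

(** A function glued from finitely many measurable functions along a
    measurable partition is measurable. *)
Lemma measurable_fun_fin_case (I : finType) (h : T -> I) (g : I -> T -> \bar R) :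
  (forall i, measurable [set t | h t = i]) ->
  (forall i, measurable_fun setT (g i)) ->
  measurable_fun setT (fun t => g (h t) t).
Proof.
move=> mh mg _ A mA; rewrite setTI.
rewrite (_ : _ @^-1` _ = \bigcup_(i in [set: I]) ([set t | h t = i] `&` g i @^-1` A)).
  apply: fin_bigcup_measurable => // i _; apply: measurableI; first exact: mh.
  by rewrite -[X in measurable X]setTI; exact: mg.
apply/seteqP; split => [t /= At|t [i _ [/= <-]]//]; exists (h t) => //.
Qed.

Lemma measurable_fin_forall (I : finType) (Q : I -> T -> bool) :
  (forall i, measurable [set t | Q i t]) -> measurable [set t | [forall i, Q i t]].
Proof.
move=> mQ; rewrite (_ : [set t | _] = \bigcap_(i in [set: I]) [set t | Q i t]).
  by apply: fin_bigcap_measurable => // i _; exact: mQ.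
apply/seteqP; split => [t /= /forallP H i _|t H]; first exact: H.
by apply/forallP => i; exact: H.
Qed.

Lemma measurable_fin_exists (I : finType) (Q : I -> T -> bool) :
  (forall i, measurable [set t | Q i t]) -> measurable [set t | [exists i, Q i t]].
Proof.
move=> mQ; rewrite (_ : [set t | _] = \bigcup_(i in [set: I]) [set t | Q i t]).
  by apply: fin_bigcup_measurable => // i _; exact: mQ.
apply/seteqP; split => [t /= /existsP[i Qi]|t [i _ Qi]]; first by exists i.
by apply/existsP; exists i.
Qed.

Lemma measurable_bool_cst (a : bool) : measurable [set _ : T | a].
Proof.
case: a; first by rewrite (_ : [set _ | _] = setT) //; apply/seteqP.
by rewrite (_ : [set _ | _] = set0) //; apply/seteqP; split => t.
Qed.

Lemma measurable_bool_eq (Q : T -> bool) (a : bool) :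
  measurable [set t | Q t] -> measurable [set t | Q t = a].
Proof.
move=> mQ; case: a => //; rewrite (_ : [set t | _] = ~` [set t | Q t]).
  exact: measurableC.
by apply/seteqP; split => t /=; case: (Q t) => // /(_ isT).
Qed.

Context (V V' : finType) (X : V * V' -> T -> R).
Hypothesis mX : forall e, measurable_fun setT (X e).

Lemma measurable_is_stable (M : {set V * V'}) :
  measurable [set t | is_stable_matching (fun v v' => X (v, v') t) M].
Proof.
case: (boolP (is_matching M)) => mM; last first.
  rewrite (_ : [set t | _] = set0) //; apply/seteqP; split => // t /=.
  by rewrite /is_stable_matching (negbTE mM).
rewrite (_ : [set t | _] = [set t | [forall e, [exists f,
   (e \in M) || [&& f \in M, adj f e & X f t < X e t]]]]); last first.
  apply/seteqP; split => t /=.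
    move=> /stableP[_ sM]; apply/forallP => e; case: (boolP (e \in M)) => [_|/sM].
      by apply/existsP; exists e.
    move=> [f fM]; rewrite -!surjective_pairing => fe.
    by apply/existsP; exists f; rewrite fM.
  move=> /forallP H; apply/stableP; split=> // e eM.
  have /existsP[f] := H e; rewrite (negbTE eM) /= => /andP[fM fe].
  by exists f; rewrite // -!surjective_pairing.
apply: measurable_fin_forall => e; apply: measurable_fin_exists => f.
case: (e \in M) => /=; first exact: (measurable_bool_cst true).
case: (f \in M) => /=; last exact: (measurable_bool_cst false).
case: (adj f e) => /=; last exact: (measurable_bool_cst false).
have := measurable_fun_ltr (mX f) (mX e) measurableT (Y := [set true]).
by rewrite setTI; apply.
Qed.

(** The stable matching is determined by the finite set of the matchings that
    are stable, which is a measurable function of the costs. *)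
Lemma measurable_stable_cost (v : V) :
  measurable_fun setT (fun t => stable_cost (fun u u' => X (u, u') t) v).
Proof.
(* There are finitely many values of [h], and the matching is a function of [h]. *)
pose h t := [set M | is_stable_matching (fun u u' => X (u, u') t) M]%SET.
pose g (H : {set {set V * V'}}) t := matching_costl (fun u u' => X (u, u') t)
  (odflt finset.set0 [pick M in H]) v.
rewrite (_ : (fun t => _) = fun t => g (h t) t); last first.
  apply/funext => t; rewrite /stable_cost /stable_matching /g /h.
  by congr matching_costl; congr odflt; apply: eq_pick => M; rewrite inE.
apply: measurable_fun_fin_case => [H|H].
  rewrite (_ : [set t | _] = [set t | [forall M, (is_stable_matching
      (fun u u' => X (u, u') t) M) == (M \in H)]]); last first.
    apply/seteqP; split => t /=.
      by move=> <-; apply/forallP => M; rewrite inE.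
    by move=> /forallP HM; apply/setP => M; rewrite inE; exact/eqP.
  apply: measurable_fin_forall => M.
  rewrite (_ : [set t | _] = [set t | is_stable_matching
      (fun u u' => X (u, u') t) M = (M \in H)]).
    exact/measurable_bool_eq/measurable_is_stable.
  by apply/seteqP; split => t /= /eqP.
rewrite /g /matching_costl; case: pickP => [v' _|_]; last exact: measurable_cst.
exact/measurable_EFinP.
Qed.

End measurability.

(** * From independent costs to a uniform order *)

Section boole.
Context d (T : measurableType d) (R : realType) (P : probability T R).

Lemma measure_le_fin_sum (I : finType) (A : pred I) (E : I -> set T) (G : set T) :
  measurable G -> (forall i, measurable (E i)) ->
  (forall t, G t -> exists2 i, A i & E i t) ->
  (P G <= \sum_(i | A i) P (E i))%E.
Proof.
move=> mG mE GE.
have [mU PU] : measurable (\big[setU/set0]_(i | A i) E i) /\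
    (P (\big[setU/set0]_(i | A i) E i) <= \sum_(i | A i) P (E i))%E.
  apply: (big_ind2 (fun (S : set T) (x : \bar R) => measurable S /\ (P S <= x)%E)).
  - by split => //; rewrite measure0.
  - move=> S x S' y [mS Sx] [mS' S'y]; split; first exact: measurableU.
    by apply: le_trans (measureU2 _ mS mS') _; exact: leeD.
  - by move=> i _; split => //.
apply: le_trans PU; apply: le_measure; rewrite ?in_setE // => t /GE[i Ai Eit].
by rewrite (bigD1 i) //=; left.
Qed.

Lemma probability_setD (A B : set T) : measurable A -> measurable B ->
  B `<=` A -> P (A `\` B) = (P A - P B)%E.
Proof.
move=> mA mB BA; rewrite [LHS]measureD // ?setIidr //.
exact: le_lt_trans (probability_le1 _ mA) (ltry _).
Qed.

End boole.

Section bins.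
Context (R : realType) (K' : nat) (s : nat -> R).
Hypothesis s_mono : forall i j, (i <= j < K')%N -> s i <= s j.

(** The index of the cell of [y] in the subdivision of the line into [K'.+1] cells
    by the [K'] points [s 0 <= s 1 <= ...]; the cells are closed on the right. *)
Definition binN (y : R) : nat := (\sum_(j < K') (s j < y)%R)%N.

Lemma sum_ltn_ord m : (m <= K')%N -> (\sum_(i < K') (i < m)%N)%N = m.
Proof.
move=> mK; rewrite -[RHS]card_ord -sum1_card (big_ord_widen _ (fun=> 1%N) mK).
by rewrite [RHS]big_mkcond; apply: eq_bigr => i _; case: ltnP.
Qed.

Lemma binN_le j y : (j < K')%N -> (binN y <= j)%N = (y <= s j).
Proof.
move=> jK; apply/idP/idP; last first.
  move=> ys; rewrite -[leqRHS](sum_ltn_ord (ltnW jK)); apply: leq_sum => i _.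
  case: (ltnP i j) => [_|ji]; first exact: leq_b1.
  by rewrite ltNge (le_trans ys) // s_mono // ji ltn_ord.
apply: contraTT; rewrite -ltNge -ltnNge => sy.
rewrite -[leqLHS](sum_ltn_ord jK); apply: leq_sum => i _.
by case: ltnP => // ij; rewrite (le_lt_trans _ sy) // s_mono // -ltnS ij.
Qed.

Lemma binN_max y : (binN y <= K')%N.
Proof.
rewrite -[leqRHS](sum_ltn_ord (leqnn K')); apply: leq_sum => i _.
by rewrite ltn_ord leq_b1.
Qed.

Lemma binN_mono : {homo binN : x y / x <= y >-> (x <= y)%N}.
Proof.
move=> x y xy; apply: leq_sum => i _; case: ltP => // sx.
by rewrite (lt_le_trans sx xy).
Qed.

Lemma binN_lt x y : (binN x < binN y)%N -> x < y.
Proof. by apply: contraTT; rewrite -leNgt -leqNgt; exact: binN_mono. Qed.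

(** [binN] with its bound. *)
Definition bin (y : R) : 'I_K'.+1 := inord (binN y).

Lemma binE y : bin y = binN y :> nat.
Proof. by rewrite inordK // ltnS binN_max. Qed.

End bins.

Lemma ffact_le_expn K M : (K ^_ M <= K ^ M)%N.
Proof. by elim: M => // M IH; rewrite ffactnSr expnSr leq_mul // leq_subr. Qed.

(** A uniformly random map from [M] points to [K] points is injective with
    probability at least [1 - M ^ 2 / K]. *)
Lemma injections_fraction (R : realFieldType) (K M : nat) : (0 < K)%N ->
  1 - (M ^ 2)%:R / K%:R <= (K ^_ M)%:R / K%:R ^+ M :> R.
Proof.
move=> K0; have k0 : 0 < K%:R :> R by rewrite ltr0n.
elim: M => [|M IH]; first by rewrite ffactn0 expr0 divr1 mul0r subr0.
have le1 : (K ^_ M)%:R / K%:R ^+ M <= 1 :> R.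
  by rewrite ler_pdivrMr ?exprn_gt0 // mul1r -natrX ler_nat ffact_le_expn.
have ge0 : 0 <= (K ^_ M)%:R / K%:R ^+ M :> R by rewrite divr_ge0 // exprn_ge0.
rewrite ffactnSr natrM exprSr invfM mulrACA.
move: IH le1 ge0; move: (_ / _ ^+ M) => a IH a1 a0.
have KM : 1 - M%:R / K%:R <= (K - M)%:R / K%:R :> R.
  rewrite ler_pdivlMr // mulrBl mul1r divfK ?lt0r_neq0 //.
  have [MK|KM] := leqP M K; first by rewrite natrB.
  by rewrite (eqP (ltnW KM)) subr_le0 ler_nat ltnW.
apply: le_trans (ler_wpM2l a0 KM).
rewrite mulrBr mulr1; apply: (@le_trans _ _ (1 - (M ^ 2)%:R / K%:R - M%:R / K%:R)).
  rewrite -addrA -opprD lerD2l lerN2 -mulrDl ler_pM2r ?invr_gt0 // -natrD ler_nat.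
  by rewrite -!mulnn addnC -mulnS leq_mul2r leqnSn orbT.
rewrite lerB // -[leRHS]mul1r ler_wpM2r // divr_ge0.
Qed.

Section transfer.
Context d (T : measurableType d) (R : realType) (P : probability T R).
Context (V : finType) (X : V * V -> {RV P >-> R}) (F : R -> R) (v : V).
Hypothesis X_indep : mutually_independent X.
Hypothesis X_cdf : forall e x, P [set t | X e t <= x] = (F x)%:E.

Let c t := stable_cost (fun u u' => X (u, u') t) v.

Let mX e : measurable_fun setT (X e) := measurable_funPT (X e).

Lemma measurable_le_cost e x : measurable [set t | X e t <= x].
Proof.
rewrite (_ : [set t | _] = X e @^-1` `]-oo, x]).
  rewrite -[X in measurable X]setTI.
  exact: (mX e measurableT (measurable_itv `]-oo, x])).
by apply/seteqP; split => t /=; rewrite in_itv.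
Qed.

Lemma cdf_mono x y : x <= y -> F x <= F y.
Proof.
move=> xy; rewrite -lee_fin -!(X_cdf (v, v)); apply: le_measure;
  rewrite ?in_setE; [exact: measurable_le_cost..|].
by move=> t /= /le_trans; apply.
Qed.

Lemma cdf_ge0 x : 0 <= F x.
Proof. by rewrite -lee_fin -(X_cdf (v, v)). Qed.

Lemma cdf_le1 x : F x <= 1.
Proof. by rewrite -lee_fin -(X_cdf (v, v)) probability_le1 //; exact: measurable_le_cost. Qed.

Lemma measurable_cost_gt x : measurable [set t | (x%:E < c t)%E].
Proof.
have := measurable_stable_cost mX v measurableT (Y := `]x%:E, +oo[%classic) (emeasurable_itv _).
rewrite setTI; congr measurable; apply/seteqP; split => t /=; rewrite in_itv /= andbT //.
Qed.

Lemma measurable_unmatched : measurable [set t | c t = +oo%E].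
Proof.
have := measurable_stable_cost mX v measurableT (Y := [set +oo%E]) (emeasurable_set1 _).
by rewrite setTI; congr measurable; apply/seteqP.
Qed.

Section fixed_mesh.
Context (K' : nat) (s : nat -> R).
Hypothesis s_quant : forall j, (j < K')%N -> F (s j) = j.+1%:R / K'.+1%:R.
Let K := K'.+1.
Let M := #|{: V * V}|.

Let s_mono i j : (i <= j < K')%N -> s i <= s j.
Proof.
move=> /andP[]; rewrite leq_eqVlt => /predU1P[->//|ij jK].
rewrite leNgt; apply/negP => /ltW/cdf_mono; apply/negP; rewrite -ltNge.
rewrite !s_quant //; last exact: ltn_trans ij jK.
by rewrite ltr_pM2r ?invr_gt0 ?ltr0n // ltr_nat.
Qed.

Let b t : {ffun V * V -> 'I_K} := [ffun e => bin K' s (X e t)].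

Lemma prob_bin_le e j : (j <= K')%N ->
  measurable [set t | (bin K' s (X e t) <= j)%N] /\
  P [set t | (bin K' s (X e t) <= j)%N] = (j.+1%:R / K%:R)%:E.
Proof.
rewrite leq_eqVlt => /predU1P[->|jK].
  rewrite (_ : [set t | _] = setT); first by rewrite probability_setT divff ?pnatr_eq0.
  by apply/seteqP; split => // t _ /=; rewrite binE binN_max.
rewrite (_ : [set t | _] = [set t | X e t <= s j]).
  by split; [exact: measurable_le_cost | rewrite X_cdf s_quant].
by apply/seteqP; split => t /=; rewrite binE binN_le.
Qed.

Lemma prob_bin e (j : 'I_K) :
  measurable [set t | bin K' s (X e t) = j] /\
  P [set t | bin K' s (X e t) = j] = (K%:R^-1)%:E.
Proof.
case: j => -[|j] jK.
  have [m0 P0] := prob_bin_le e (leq0n K').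
  rewrite (_ : [set t | _] = [set t | (bin K' s (X e t) <= 0)%N]).
    by rewrite P0 mul1r.
  apply/seteqP; split => t /=; first by move=> ->.
  by rewrite leqn0 => /eqP bt; apply/val_inj.
have [m1 P1] := prob_bin_le e (ltnW jK).
(* A cell is the difference of two consecutive half-lines. *)
have [m2 P2] := prob_bin_le e (j := j.+1) jK.
have E : [set t | bin K' s (X e t) = Ordinal jK] =
    [set t | (bin K' s (X e t) <= j.+1)%N] `\` [set t | (bin K' s (X e t) <= j)%N].
  apply/seteqP; split => t /=; first by move=> -> /=; split; rewrite ?ltnn.
  by case=> le /negP; rewrite -ltnNge => ge; apply/val_inj/eqP; rewrite /= eqn_leq le.
rewrite E; split; first exact: measurableD.
rewrite probability_setD //; last by move=> t /= /leqW.
by rewrite P1 P2 -EFinB -mulrBl -natrB // subSnn mul1r.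
Qed.

Let p0 : R := (K%:R ^+ M)^-1.

(** The cells of the costs are independent and uniform. *)
Lemma prob_bins (f : {ffun V * V -> 'I_K}) :
  measurable [set t | b t = f] /\ P [set t | b t = f] = p0%:E.
Proof.
pose A e := [set y | bin K' s y = f e].
have mA e : measurable (A e).
  have binNm j : measurable [set y : R | (binN K' s y <= j)%N].
    have [jK|Kj] := ltnP j K'.
      rewrite (_ : [set y | _] = `]-oo, s j]%classic); first exact: measurable_itv.
      by apply/seteqP; split => y /=; rewrite binN_le // in_itv.
    rewrite (_ : [set y | _] = setT) //; apply/seteqP; split => // y _ /=.
    exact: leq_trans (binN_max _ _ _) Kj.
  case E : (f e : nat) => [|j].
    rewrite /A (_ : [set y | _] = [set y : R | (binN K' s y <= 0)%N]) //.
    apply/seteqP; split => y /=; first by move=> /(congr1 val) /=; rewrite binE E => ->.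
    by rewrite leqn0 => /eqP yE; apply/val_inj; rewrite /= binE E.
  rewrite /A (_ : [set y | _] = [set y : R | (binN K' s y <= j.+1)%N] `\`
     [set y : R | (binN K' s y <= j)%N]); first exact: measurableD.
  apply/seteqP; split => y /=.
    by move=> /(congr1 val) /=; rewrite binE E => ->; split; rewrite ?ltnn.
  case=> le /negP; rewrite -ltnNge => ge; apply/val_inj/eqP.
  by rewrite /= binE E eqn_leq le.
have E : [set t | b t = f] = \bigcap_(e in [set` [set: V * V]%SET]) (X e @^-1` A e).
  apply/seteqP; split => [t /= bt e _ /=|t H].
    by rewrite /A /= -bt ffunE.
  apply/ffunP => e; rewrite ffunE; apply: (H e); by rewrite /= finset.in_setT.
split.
  rewrite E; apply: fin_bigcap_measurable => // e _.
  by rewrite -[X in measurable X]setTI; exact: mX.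
rewrite E X_indep //.
under eq_bigr => e _ do rewrite (prob_bin e (f e)).2.
by rewrite prodEFin prodr_const cardsT exprVn.
Qed.

(** If the costs lie in distinct cells, then the cells are ordered like the
    costs and the two matchings coincide. *)
Lemma rank_matching_bins t : injective (b t) ->
  rank_matching R (b t) = stable_matching (fun u u' => X (u, u') t).
Proof.
move=> bI; have lt e f : (b t e < b t f)%N -> X e t < X f t.
  by rewrite !ffunE !binE; exact: binN_lt.
have ltE e f : (b t e < b t f)%N = (X e t < X f t).
  apply/idP/idP => [|ef]; first exact: lt.
  rewrite ltnNge leq_eqVlt negb_or -leqNgt; apply/andP; split.
    by apply: contraTneq ef => /val_inj/bI ->; rewrite ltxx.
  by rewrite leqNgt; apply/negP => /lt/(lt_trans ef); rewrite ltxx.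
apply/setP => e; apply: (stable_agree (w' := fun u u' => X (u, u') t)
  (S := predT) (rank_matching_stable R bI)) => //.
  apply: stable_matchingP => {}e f; rewrite -!surjective_pairing => ef.
  by apply/bI/val_inj/eqP; rewrite eqn_leq 2!(leqNgt (b t _)) !ltE ef ltxx.
by move=> {}e f _; rewrite !rank_weightE ltr_nat -!surjective_pairing ltE.
Qed.

Let k x : nat := bin K' s x.

Lemma cost_gt_free t x : injective (b t) -> (x%:E < c t)%E ->
  ~~ used_l R (k x) (b t) v.
Proof.
move=> bI; apply: contraTN => /exists_inP[e eM /andP[/eqP ev lt]]; rewrite -leNgt.
rewrite /c /stable_cost -rank_matching_bins // -ev costl_matched ?is_matching_rank_matching //.
rewrite lee_fin -surjective_pairing ltW // (@binN_lt _ K' s) //.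
by move: lt; rewrite ffunE /k !binE.
Qed.

Lemma free_cost_gt t x : injective (b t) -> ~~ used_l R (k x).+1 (b t) v ->
  (x%:E < c t)%E.
Proof.
move=> bI fr; rewrite /c /stable_cost -rank_matching_bins // /matching_costl.
case: pickP => [v' vM|_]; last exact: ltry.
rewrite lte_fin (@binN_lt _ K' s) // -!binE -/(k x) ltnNge; apply: contra fr => le.
by apply/exists_inP; exists (v, v'); rewrite // eqxx ffunE ltnS.
Qed.

Lemma cost_lty t : injective (b t) -> (c t < +oo)%E.
Proof.
move=> bI; have /exists_inP[e eM /andP[/eqP ev _]] := used_l_total R v bI.
rewrite /c /stable_cost -rank_matching_bins // -ev costl_matched ?is_matching_rank_matching //.
exact: ltry.
Qed.

(** [F x] is known up to the size of the mesh from the cell of [x]. *)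
Lemma cdf_bin x : (k x)%:R / K%:R <= F x <= (k x).+1%:R / K%:R.
Proof.
have K0 : 0 < K%:R :> R by rewrite ltr0n.
rewrite /k binE; apply/andP; split.
  case E : (binN K' s x) => [|j]; first by rewrite mul0r cdf_ge0.
  have jK : (j < K')%N by rewrite -E binN_max.
  by rewrite -s_quant // cdf_mono // ltW // ltNge -(binN_le s_mono) // E ltnn.
have := binN_max K' s x; rewrite leq_eqVlt => /predU1P[->|jK].
  by rewrite divff ?lt0r_neq0 // cdf_le1.
by rewrite -s_quant // cdf_mono // -(binN_le s_mono).
Qed.

Hypothesis MK : (M <= K)%N.

Let inj_gt0 : (0 < #|[pred f : {ffun V * V -> 'I_K} | injectiveb f]|)%N.
Proof.
by have := card_inj_ffuns {: V * V}  'I_K; rewrite cardsE => ->; rewrite ffact_gt0 card_ord.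
Qed.

Let nI : R := #|[pred f : {ffun V * V -> 'I_K} | injectiveb f]|%:R.

Let nI_p0 : 1 - (M ^ 2)%:R / K%:R <= nI * p0 <= 1.
Proof.
have -> : nI = (K ^_ M)%:R.
  by rewrite /nI; have := card_inj_ffuns {: V * V}  'I_K; rewrite cardsE card_ord => ->.
rewrite injections_fraction //= /p0 ler_pdivrMr ?exprn_gt0 ?ltr0n // mul1r -natrX.
by rewrite ler_nat ffact_le_expn.
Qed.

(** The probability that the cells are not distinct or satisfy [A]. *)
Lemma sum_p0 (A : pred {ffun V * V -> 'I_K}) :
  (\sum_(f : {ffun V * V -> 'I_K} | injectiveb f ==> A f) P [set t | b t = f])%E =
  (inj_avg (fun f => (A f)%:R : R) * (nI * p0) + (1 - nI * p0))%:E.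
Proof.
under eq_bigr => f _ do rewrite (prob_bins f).2.
rewrite sumEFin sumr_const -mulr_natl; congr EFin.
have tot : K%:R ^+ M * p0 = 1 by rewrite mulfV // expf_neq0 // pnatr_eq0.
rewrite -[X in _ + (X - _)]tot mulrA -mulrBl -mulrDl; congr (_ * _).
have nI0 : nI != 0 by rewrite pnatr_eq0 -lt0n.
rewrite /inj_avg -/nI divfK // -natr_sum.
have -> : K%:R ^+ M = #|{ffun V * V -> 'I_K}|%:R :> R.
  by rewrite card_ffun card_ord natrX.
rewrite /nI -natrB ?max_card // -natrD; congr (_%:R).
rewrite -[#|{ffun _}| ](cardC [pred f : {ffun V * V -> 'I_K} | injectiveb f]) addKn.
rewrite -!sum1_card big_mkcond [in RHS]big_mkcond [X in (_ + X)%N]big_mkcond -big_split.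
apply: eq_bigr => f _; rewrite !inE /in_mem /=.
by case: injectiveb; case: (A f).
Qed.

(** If the cost of [v] exceeds [x] and the cells are distinct, then [v] is free
    when the cell of [x] is reached. *)
Lemma tail_le_mesh x :
  (P [set t | (x%:E < c t)%E] <=
    ((1 + #|V|%:R * F x)^-1 + (#|V| + M ^ 2)%:R / K%:R)%:E)%E.
Proof.
have H : (P [set t | (x%:E < c t)%E] <= \sum_(f : {ffun V * V -> 'I_K} |
    injectiveb f ==> ~~ used_l R (k x) f v) P [set t | b t = f])%E.
  apply: measure_le_fin_sum => [||t xc]; first exact: measurable_cost_gt.
    by move=> f; exact: (prob_bins f).1.
  by exists (b t) => //; apply/implyP => /injectiveP bI; exact: cost_gt_free.
apply: le_trans H _; rewrite sum_p0 lee_fin.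
have kK : (k x <= K)%N by exact: ltnW (ltn_ord _).
have V0 : (0 < #|V|)%N by apply/card_gt0P; exists v.
have := free_prob_le R inj_gt0 V0 v kK.
have r0 : 0 <= inj_avg (fun f : {ffun V * V -> 'I_K} => (~~ used_l R (k x) f v)%:R : R).
  by rewrite -[X in X <= _](inj_avg_cst inj_gt0 0); apply: ler_inj_avg.
move: r0 nI_p0; move: (nI * p0) (inj_avg _) => a r r0 /andP[a1 a2] rle.
have [+ _] := andP (cdf_bin x) => _.
have /andP[_ Fk] := cdf_bin x.
have K0 : 0 < K%:R :> R by rewrite ltr0n.
have n0 : 0 <= #|V|%:R :> R by [].
have kK0 : 0 <= (k x)%:R / K%:R :> R by rewrite divr_ge0.
(* Replacing the rank by [F x] costs at most [#|V| / K]. *)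
have Hd : (1 + #|V|%:R * ((k x)%:R / K%:R))^-1 <=
    (1 + #|V|%:R * F x)^-1 + #|V|%:R / K%:R.
  move: Fk; rewrite -natr1 mulrDl mul1r; move: kK0 (cdf_ge0 x).
  move: n0; set n := #|V|%:R; set z := _ / _; set y := K%:R^-1; set w := F x => n0 z0 w0 wz.
  rewrite -lerBlDl.
  have nz : 0 < 1 + n * z by rewrite ltr_pwDl // mulr_ge0.
  have nw : 0 < 1 + n * w by rewrite ltr_pwDl // mulr_ge0.
  rewrite (_ : _ - _ = n * (w - z) / ((1 + n * z) * (1 + n * w))); last first.
    by field; rewrite !lt0r_neq0.
  apply: (@le_trans _ _ (n * y / ((1 + n * z) * (1 + n * w)))).
    by rewrite ler_wpM2r ?invr_ge0 ?mulr_ge0 ?(ltW nz) ?(ltW nw) // ler_wpM2l //; lra.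
  have y0 : 0 <= y by rewrite invr_ge0 ltW.
  rewrite ler_pdivrMr ?mulr_gt0 // ler_peMr ?mulr_ge0 //.
  by rewrite mulr_ege1 // lerDl mulr_ge0.
apply: (@le_trans _ _ (r + (M ^ 2)%:R / K%:R)).
  by rewrite lerD ?ler_piMr //; lra.
by rewrite natrD mulrDl addrA lerD2r (le_trans rle).
Qed.

(** If [v] is free once the cell of [x] has been passed, then its cost exceeds
    [x]. *)
Lemma tail_ge_mesh x : ((bin K' s x).+1 < K)%N ->
  (((1 - (F x + K%:R^-1)) / (1 - (F x + K%:R^-1) + #|V|%:R * (F x + K%:R^-1))
     - #|V|%:R^-1 - (M ^ 2)%:R / K%:R)%:E <= P [set t | (x%:E < c t)%E])%E.
Proof.
move=> kK.
have H : (P (~` [set t | (x%:E < c t)%E]) <= \sum_(f : {ffun V * V -> 'I_K} |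
    injectiveb f ==> used_l R (k x).+1 f v) P [set t | b t = f])%E.
  apply: measure_le_fin_sum => [||t xc]; first exact/measurableC/measurable_cost_gt.
    by move=> f; exact: (prob_bins f).1.
  exists (b t) => //; apply/implyP => /injectiveP bI.
  by apply: contrapT => /negP fr; apply: xc; exact: free_cost_gt.
move: H; rewrite sum_p0.
have V0 : (0 < #|V|)%N by apply/card_gt0P; exists v.
have := free_prob_ge R inj_gt0 V0 v kK.
rewrite -/(k x).
have rE : inj_avg (fun f : {ffun V * V -> 'I_K} => (used_l R (k x).+1 f v)%:R : R) =
   1 - inj_avg (fun f : {ffun V * V -> 'I_K} => (~~ used_l R (k x).+1 f v)%:R : R).
  apply/eqP; rewrite eq_sym subr_eq -inj_avgD -[X in X == _](inj_avg_cst inj_gt0 1).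
  by apply/eqP/eq_inj_avg => f _; case: used_l; rewrite ?addr0 ?add0r.
rewrite rE.
have r1 : inj_avg (fun f : {ffun V * V -> 'I_K} => (~~ used_l R (k x).+1 f v)%:R : R) <= 1.
  rewrite -[X in _ <= X](inj_avg_cst inj_gt0 1); apply: ler_inj_avg => f _.
  by case: used_l.
have Pfin : P [set t | (x%:E < c t)%E] \is a fin_num.
  by apply: fin_num_measure; exact: measurable_cost_gt.
rewrite probability_setC; last exact: measurable_cost_gt.
rewrite -(fineK Pfin) -EFinB !lee_fin.
move: (fine _) r1 nI_p0; move: (nI * p0) (inj_avg _) => a r g r1 /andP[a1 a2] rge.
have /andP[kF _] := cdf_bin x.
have K0 : 0 < K%:R :> R by rewrite ltr0n.
have n1 : 1 <= #|V|%:R :> R by rewrite ler1n.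
have kK1 : (k x).+1%:R / K%:R < 1 :> R by rewrite ltr_pdivrMr // mul1r ltr_nat.
have y0 : 0 <= (k x).+1%:R / K%:R :> R by rewrite divr_ge0.
have yF : (k x).+1%:R / K%:R <= F x + K%:R^-1 by rewrite -natr1 mulrDl mul1r lerD2r.
have yE : (k x).+1%:R / (K - (k x).+1)%:R =
    ((k x).+1%:R / K%:R) / (1 - (k x).+1%:R / K%:R) :> R.
  by rewrite natrB 1?ltnW //; field; rewrite !lt0r_neq0 // subr_gt0 nat1r ltr_nat.
move: rge; rewrite yE; move: kK1 y0 yF; set y := _ / _; set w := F x + _; set n := #|V|%:R in n1 *.
move=> y1 y0 yw rge gle.
(* The bound at rank [k x + 1], with [y = (k x + 1) / K], weakened to [w = F x + 1 / K]. *)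
have Hg : (1 - w) / (1 - w + n * w) <= (1 + n * (y / (1 - y)))^-1.
  have -> : (1 + n * (y / (1 - y)))^-1 = (1 - y) / (1 - y + n * y).
    have : 0 < 1 - y + n * y by rewrite ltr_pwDl ?subr_gt0 // mulr_ge0 //; lra.
    by move=> ny; field; rewrite !lt0r_neq0 ?subr_gt0.
  have ny : 0 < 1 - y + n * y by rewrite ltr_pwDl ?subr_gt0 // mulr_ge0 //; lra.
  have nw : 0 < 1 - w + n * w.
    have : 0 <= (n - 1) * w by rewrite mulr_ge0 //; lra.
    rewrite mulrBl; lra.
  rewrite ler_pdivrMr // mulrAC ler_pdivlMr // -subr_ge0.
  rewrite (_ : _ - _ = n * (w - y)); last by ring.
  by rewrite mulr_ge0 //; lra.
have : (1 - r) * a + (1 - a) <= 1 - r + (M ^ 2)%:R / K%:R.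
  rewrite lerD //; last by lra.
  by rewrite ler_piMr //; lra.
by lra.
Qed.

Lemma prob_unmatched_mesh : (P [set t | c t = +oo%E] <= ((M ^ 2)%:R / K%:R)%:E)%E.
Proof.
have H : (P [set t | c t = +oo%E] <= \sum_(f : {ffun V * V -> 'I_K} |
    injectiveb f ==> pred0 f) P [set t | b t = f])%E.
  apply: measure_le_fin_sum => [||t ct]; first exact: measurable_unmatched.
    by move=> f; exact: (prob_bins f).1.
  exists (b t) => //; apply/implyP => /injectiveP/cost_lty.
  by rewrite ct ltxx.
apply: le_trans H _; rewrite sum_p0 lee_fin.
have /= -> := inj_avg_cst inj_gt0 0.
by have /andP[+ _] := nI_p0; lra.
Qed.

End fixed_mesh.

Hypothesis F_quantile : forall u, 0 < u < 1 -> exists s, F s = u.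

Lemma quantiles K' : exists s : nat -> R,
  forall j, (j < K')%N -> F (s j) = j.+1%:R / K'.+1%:R.
Proof.
have H j : exists s, (j < K')%N -> F s = j.+1%:R / K'.+1%:R.
  have [jK|] := boolP (j < K')%N; last by exists 0.
  have [|s] := F_quantile (u := j.+1%:R / K'.+1%:R); last by exists s.
  by rewrite divr_gt0 ?ltr0n //= ltr_pdivrMr ?ltr0n // mul1r ltr_nat ltnS.
by exists (fun j => sval (cid (H j))) => j; exact: svalP (cid (H j)).
Qed.

Lemma small_mesh (C e : R) m : 0 <= C -> 0 < e ->
  exists2 K' : nat, (m <= K')%N & C / K'.+1%:R <= e.
Proof.
move=> C0 e0; exists (maxn m (Num.bound (C / e))); first exact: leq_maxl.
rewrite ler_pdivrMr ?ltr0n // mulrC -ler_pdivrMr //.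
have := archi_boundP (divr_ge0 C0 (ltW e0)) => /ltW/le_trans; apply.
by rewrite ler_nat leqW // leq_maxr.
Qed.

(** The upper half of the sandwich. *)
Theorem cost_tail_le x :
  (P [set t | (x%:E < c t)%E] <= ((1 + #|V|%:R * F x)^-1)%:E)%E.
Proof.
have Pfin : P [set t | (x%:E < c t)%E] \is a fin_num.
  by apply: fin_num_measure; exact: measurable_cost_gt.
rewrite -(fineK Pfin) lee_fin; apply/ler_addgt0Pr => e e0.
have [K' MK Ke] := small_mesh #|{: V * V}| (ler0n _ (#|V| + #|{: V * V}| ^ 2)) e0.
have [s sq] := quantiles K'.
have := tail_le_mesh sq (leqW MK) x; rewrite -(fineK Pfin) lee_fin => /le_trans; apply.
by rewrite lerD2l.
Qed.

(** Almost surely every vertex is matched. *)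
Lemma unmatched_null : P [set t | c t = +oo%E] = 0%E.
Proof.
have Pfin : P [set t | c t = +oo%E] \is a fin_num.
  by apply: fin_num_measure; exact: measurable_unmatched.
apply/eqP; rewrite eq_le measure_ge0 andbT -(fineK Pfin) lee_fin.
apply/ler_addgt0Pr => e e0.
have [K' MK Ke] := small_mesh #|{: V * V}| (ler0n _ (#|{: V * V}| ^ 2)) e0.
have [s sq] := quantiles K'.
have := prob_unmatched_mesh sq (leqW MK); rewrite -(fineK Pfin) lee_fin => /le_trans; apply.
by rewrite add0r.
Qed.

(** The lower half of the sandwich; the first term equals
    [1 / (1 + #|V| * (F x / (1 - F x)))]. *)
Theorem cost_tail_ge x : F x < 1 ->
  (((1 - F x) / (1 - F x + #|V|%:R * F x) - #|V|%:R^-1)%:E <=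
    P [set t | (x%:E < c t)%E])%E.
Proof.
move=> F1.
have Pfin : P [set t | (x%:E < c t)%E] \is a fin_num.
  by apply: fin_num_measure; exact: measurable_cost_gt.
rewrite -(fineK Pfin) lee_fin; apply/ler_addgt0Pr => e e0.
have e'0 : 0 < Num.min e (1 - F x) by rewrite lt_min e0 subr_gt0.
have [K' MK] := small_mesh #|{: V * V}| (ler0n _ (#|V| + #|{: V * V}| ^ 2 + 1)) e'0.
rewrite le_min => /andP[Ke K1].
have [s sq] := quantiles K'.
have K0 : 0 < K'.+1%:R :> R by rewrite ltr0n.
have V0 : (0 < #|V|)%N by apply/card_gt0P; exists v.
have n1 : 1 <= #|V|%:R :> R by rewrite ler1n.
(* As [F x < 1], the cell of [x] is not the last one when the mesh is fine. *)
have kK : ((bin K' s x).+1 < K'.+1)%N.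
  have /andP[kF _] := cdf_bin sq x.
  rewrite ltnS ltn_neqAle -ltnS ltn_ord andbT; apply/eqP => kE.
  move: kF; rewrite kE => kF.
  have : K'.+1%:R^-1 < 1 - F x.
    apply: lt_le_trans K1; rewrite -[X in X < _]mul1r ltr_pM2r ?invr_gt0 //.
    by rewrite ltr1n addn1 ltnS addn_gt0 V0.
  have : K'%:R / K'.+1%:R = 1 - K'.+1%:R^-1 :> R.
    by rewrite -[in LHS]natr1; field.
  move=> E; move: kF; rewrite E.
  by move: (K'.+1%:R^-1) (F x) => y w; lra.
have := tail_ge_mesh sq (leqW MK) kK; rewrite -(fineK Pfin) lee_fin.
move: Ke; rewrite !natrD !mulrDl mul1r.
move: (fine _) => g; move: (cdf_ge0 x) F1 => /= w0 w1 Ke; move: w0 w1 Ke.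
have : 0 < K'.+1%:R^-1 :> R by rewrite invr_gt0.
move: ((#|{: V * V}| ^ 2)%:R / K'.+1%:R) => z; move: n1; set n := #|V|%:R; move: (K'.+1%:R^-1) (F x) => y w.
move=> n1 y0 w0 w1 ye gge.
have d1 u : 0 <= u -> 1 <= 1 - u + n * u.
  by move=> u0; have : 0 <= (n - 1) * u; [rewrite mulr_ge0 //; lra | rewrite mulrBl; lra].
have dw := d1 w w0; have dy := d1 (w + y) (addr_ge0 w0 (ltW y0)).
have : (1 - w) / (1 - w + n * w) - (1 - (w + y)) / (1 - (w + y) + n * (w + y)) <= n * y.
  rewrite (_ : _ - _ = n * y / ((1 - w + n * w) * (1 - (w + y) + n * (w + y)))); last first.
    by field; apply/andP; split; lra.
  rewrite ler_pdivrMr; last by rewrite mulr_gt0; lra.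
  by rewrite ler_peMr ?mulr_ege1 // mulr_ge0; lra.
by lra.
Qed.

End transfer.

(** * The distribution function of the costs *)

Lemma at_right0_ex (R : realType) (Q : R -> Prop) :
  (\forall x \near 0^'+, Q x) -> exists2 e : R, 0 < e & forall x, 0 < x < e -> Q x.
Proof.
case=> e /= e0 H; exists e => // x /andP[x0 xe]; apply: H => //=.
by rewrite sub0r normrN gtr0_norm.
Qed.

Section power_integral.
Context {R : realType}.
Notation mu := (@lebesgue_measure R).

Lemma continuous_powR (a x : R) : 0 < x -> {for x, continuous (fun y : R => y `^ a)}.
Proof.
move=> x0; apply/differentiable_continuous/derivable1_diffP.
by apply: derivable_powR; rewrite in_itv /= x0.
Qed.

Lemma integrable_powR (c a l r : R) : 0 < l ->
  mu.-integrable `[l, r] (EFin \o (fun y : R => c * y `^ a)).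
Proof.
move=> l0; apply: continuous_compact_integrable; first exact: segment_compact.
apply: continuous_in_subspaceT => x; rewrite inE /= in_itv /= => /andP[lx _].
apply: cvgM; first exact: cvg_cst.
by apply: continuous_powR; exact: lt_le_trans lx.
Qed.

Lemma Rintegral_powR (d l r : R) : 0 < l < r ->
  \int[mu]_(y in `[l, r]) (d * y `^ (d - 1)) = r `^ d - l `^ d.
Proof.
move=> /andP[l0 lr]; rewrite /Rintegral.
rewrite (@continuous_FTC2 _ _ (fun y => y `^ d)) ?fineB //=.
- apply: continuous_in_subspaceT => x; rewrite inE /= in_itv /= => /andP[lx _].
  apply: cvgM; first exact: cvg_cst.
  by apply: continuous_powR; exact: lt_le_trans lx.
- split => [x||].
  + rewrite in_itv /= => /andP[lx _]; apply: derivable_powR.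
    by rewrite in_itv /= (lt_trans l0 lx).
  + by apply: cvg_at_right_filter; exact: continuous_powR.
  + by apply: cvg_at_left_filter; apply: continuous_powR; exact: lt_trans lr.
- move=> x; rewrite in_itv /= => /andP[lx _].
  by rewrite powR_derive1 // in_itv /= (lt_trans l0 lx).
Qed.

End power_integral.

Section distribution_function.
Context (R : realType) (d : R) (rho : R -> R).
Hypothesis d_gt0 : 0 < d.
Hypothesis rho_density : is_density rho.
Notation mu := (@lebesgue_measure R).

(** The distribution function of the density [rho]. It vanishes for [x < 0], as
    the interval is then empty. *)
Definition dcdf (x : R) : R := \int[mu]_(y in `[0, x]) rho y.

Let mrho : measurable_fun (`[0, +oo[ : set R) rho.
Proof. by case: rho_density. Qed.

Let rho_ge0 x : 0 <= x -> 0 <= rho x.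
Proof. by case: rho_density => _ + _; exact. Qed.

Lemma integrable_density : mu.-integrable `[0, +oo[ (EFin \o rho).
Proof.
apply/integrableP; split; first exact/measurable_EFinP.
have [_ _ rho1] := rho_density.
apply: (@le_lt_trans _ _ 1%E); last exact: ltry.
rewrite -rho1 le_eqVlt; apply/orP; left; apply/eqP/eq_integral => x.
by rewrite inE /= in_itv /= andbT => x0; rewrite ger0_norm // rho_ge0.
Qed.

Lemma integrable_density_itv a b : 0 <= a -> mu.-integrable `[a, b] (EFin \o rho).
Proof.
move=> a0; apply: integrableS integrable_density => // x /=.
by rewrite !in_itv /= andbT => /andP[/(le_trans a0)].
Qed.

Lemma dcdf_continuous b : 0 <= b -> {within `[0, b], continuous dcdf}.
Proof. by move=> b0; apply: parameterized_integral_continuous => //; exact: integrable_density_itv. Qed.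

Lemma dcdf_le0 x : x <= 0 -> dcdf x = 0.
Proof.
rewrite le_eqVlt => /predU1P[->|x0]; rewrite /dcdf.
  by rewrite set_itv1 Rintegral_set1.
by rewrite set_itv_ge ?Rintegral_set0 // bnd_simp -ltNge.
Qed.

Lemma dcdf_ge0 x : 0 <= dcdf x.
Proof.
apply: Rintegral_ge0 => y /=; rewrite in_itv /= => /andP[y0 _]; exact: rho_ge0.
Qed.

Lemma dcdfB a b : 0 <= a -> a <= b -> dcdf b - dcdf a = \int[mu]_(y in `[a, b]) rho y.
Proof.
move=> a0 ab; rewrite /dcdf Rintegral_itvB ?bnd_simp //.
  apply: Rintegral_itv_obnd_cbnd.
  apply: integrableS (integrable_density_itv b a0) => //.
  by apply: subset_itvr; rewrite bnd_simp.
exact: integrable_density_itv.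
Qed.

Lemma dcdf_cvg0 : dcdf x @[x --> 0^'+] --> (0 : R).
Proof.
have := dcdf_continuous ler01 => /(continuous_within_itvP _ ltr01)[_ + _].
by rewrite dcdf_le0.
Qed.

Lemma dcdf_lower lo delta x :
  (forall y, 0 < y < delta -> lo * (d * y `^ (d - 1)) <= rho y) -> 0 < x < delta ->
  lo * x `^ d <= dcdf x.
Proof.
move=> H /andP[x0 xd].
apply: (@ler_cvg_to _ (0 : R)^'+ _ _ (fun a => lo * (x `^ d - a `^ d)) (fun=> dcdf x)).
- rewrite -[X in _ --> lo * X]subr0.
  by apply: cvgM; [exact: cvg_cst | apply: cvgB; [exact: cvg_cst | exact: powR_cvg0]].
- exact: cvg_cst.
near=> a.
have a0 : 0 < a by [].
have ax : a < x by near: a; exact: nbhs_right_lt.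
rewrite -(Rintegral_powR d (l := a)) ?a0 //.
apply: (@le_trans _ _ (dcdf x - dcdf a)); last by rewrite lerBlDr lerDl dcdf_ge0.
rewrite dcdfB ?(ltW a0) ?(ltW ax) // -RintegralZl //; last exact: integrable_powR.
apply: le_Rintegral => //.
- rewrite (_ : EFin \o _ = EFin \o (fun y => lo * d * y `^ (d - 1))); last first.
    by apply/funext => y /=; rewrite mulrA.
  exact: integrable_powR.
- by apply: integrable_density_itv; exact: ltW.
- move=> y /=; rewrite in_itv /= => /andP[ay yx]; apply: H.
  by rewrite (lt_le_trans a0 ay) (le_lt_trans yx xd).
Unshelve. all: by end_near. Qed.

Lemma dcdf_upper hi delta x :
  (forall y, 0 < y < delta -> rho y <= hi * (d * y `^ (d - 1))) -> 0 < x < delta ->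
  dcdf x <= hi * x `^ d.
Proof.
move=> H /andP[x0 xd].
apply: (@ler_cvg_to _ (0 : R)^'+ _ _ (fun=> dcdf x)
  (fun a => hi * (x `^ d - a `^ d) + dcdf a)).
- exact: cvg_cst.
- rewrite -[X in _ --> X]addr0; apply: cvgD; last exact: dcdf_cvg0.
  rewrite -[X in _ --> hi * X]subr0.
  by apply: cvgM; [exact: cvg_cst | apply: cvgB; [exact: cvg_cst | exact: powR_cvg0]].
near=> a.
have a0 : 0 < a by [].
have ax : a < x by near: a; exact: nbhs_right_lt.
rewrite -(Rintegral_powR d (l := a)) ?a0 // -lerBlDr.
rewrite dcdfB ?(ltW a0) ?(ltW ax) // -RintegralZl //; last exact: integrable_powR.
apply: le_Rintegral => //.
- by apply: integrable_density_itv; exact: ltW.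
- rewrite (_ : EFin \o _ = EFin \o (fun y => hi * d * y `^ (d - 1))); last first.
    by apply/funext => y /=; rewrite mulrA.
  exact: integrable_powR.
- move=> y /=; rewrite in_itv /= => /andP[ay yx]; apply: H.
  by rewrite (lt_le_trans a0 ay) (le_lt_trans yx xd).
Unshelve. all: by end_near. Qed.

Hypothesis rho_near0 : rho x / (d * x `^ (d - 1)) @[x --> 0^'+] --> (1 : R).

(** [dcdf x] is equivalent to [x ^ d] at the origin. *)
Lemma dcdf_near0 (eps : R) : 0 < eps ->
  exists2 delta, 0 < delta & forall x, 0 <= x < delta ->
    (1 - eps) * x `^ d <= dcdf x <= (1 + eps) * x `^ d.
Proof.
move=> e0; have [delta d0 H] := at_right0_ex (cvgr_dist_lt _ _ rho_near0 _ e0).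
exists delta => // x /andP[]; rewrite le_eqVlt => /predU1P[<- _|x0 xd].
  by rewrite powR0 ?gt_eqF // !mulr0 dcdf_le0 // lexx.
have g0 y : 0 < y -> 0 < d * y `^ (d - 1) by move=> y0; rewrite mulr_gt0 ?powR_gt0.
apply/andP; split.
  apply: (@dcdf_lower _ delta) => [y yd|]; last by rewrite x0.
  have /andP[y0 _] := yd; have := H _ yd; rewrite distrC ltr_distl => /andP[/ltW + _].
  by rewrite ler_pdivlMr ?g0.
apply: (@dcdf_upper _ delta) => [y yd|]; last by rewrite x0.
have /andP[y0 _] := yd; have := H _ yd; rewrite distrC ltr_distl => /andP[_ /ltW].
by rewrite ler_pdivrMr ?g0.
Qed.

Section random_variable.
Context disp (T : measurableType disp) (P : probability T R) (X : {RV P >-> R}).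
Hypothesis X_density : has_density X rho.

Let le_preimage x : [set t | X t <= x] = X @^-1` `]-oo, x].
Proof. by apply/seteqP; split => t /=; rewrite in_itv. Qed.

Lemma density_cdf x : P [set t | X t <= x] = (dcdf x)%:E.
Proof.
rewrite le_preimage; transitivity (distribution P X `]-oo, x]); first by [].
rewrite X_density //.
rewrite (_ : `]-oo, x] `&` `[0, +oo[ = `[0, x]%classic); last first.
  apply/seteqP; split => y /=; rewrite !in_itv /= andbT; first by case=> -> ->.
  by move=> /andP[-> ->].
rewrite /dcdf /Rintegral fineK //.
apply: integrable_fin_num => //; exact: integrable_density_itv.
Qed.

Lemma density_quantile u : 0 < u < 1 -> exists s, dcdf s = u.
Proof.
move=> /andP[u0 u1].
have [b ub] : exists b, u < dcdf b.
  apply: contrapT => /forallNP H.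
  have : (1 <= u%:E)%E.
    apply: (cvge_to_le (@cvg_cdfy1 _ _ _ P X)); near=> b.
    have -> : cdf X b = (dcdf b)%:E.
      by rewrite -density_cdf le_preimage.
    by rewrite lee_fin leNgt; apply/negP/H.
  by rewrite lee_fin leNgt u1.
have b0 : 0 <= b by rewrite leNgt; apply: contraTN ub => /ltW/dcdf_le0 ->; rewrite -leNgt ltW.
have [|s _ <-] := IVT (v := u) b0 (dcdf_continuous b0); last by exists s.
rewrite dcdf_le0 // ge_min le_max (ltW u0) (ltW ub) /= orbT //.
Unshelve. all: by end_near. Qed.

Lemma density_ge0_ae : P [set t | X t < 0] = 0.
Proof.
have -> : [set t | X t < 0] = X @^-1` `]-oo, 0[.
  by apply/seteqP; split => t /=; rewrite in_itv.
transitivity (distribution P X `]-oo, 0[); first by [].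
rewrite X_density // (_ : _ `&` _ = set0) ?integral_set0 //.
apply/seteqP; split => y //=; rewrite !in_itv /= andbT => -[].
by rewrite ltNge => /negP.
Qed.

(** Markov's inequality for the moment of order [r]. *)
Lemma density_tail r x : 0 <= r -> 0 < x ->
  (\int[mu]_(y in `[0%R, +oo[) (y `^ r * rho y)%:E < +oo)%E ->
  (P [set t | (x < X t)%R] <=
    (fine (\int[mu]_(y in `[0%R, +oo[) (y `^ r * rho y)%:E) / x `^ r)%:E)%E.
Proof.
move=> r0 x0 fin_mom.
have g0 y : 0 <= y -> (0 <= (y `^ r * rho y)%:E)%E.
  by move=> y0; rewrite lee_fin mulr_ge0 ?powR_ge0 ?rho_ge0.
have mom0 : (0 <= \int[mu]_(y in `[0%R, +oo[) (y `^ r * rho y)%:E)%E.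
  by apply: integral_ge0 => y /=; rewrite in_itv /= andbT; exact: g0.
have -> : [set t | x < X t] = X @^-1` `]x, +oo[.
  by apply/seteqP; split => t /=; rewrite in_itv /= andbT.
have -> : P (X @^-1` `]x, +oo[) = distribution P X `]x, +oo[ by [].
rewrite X_density //.
rewrite (_ : `]x, +oo[ `&` `[0, +oo[ = `]x, +oo[%classic); last first.
  apply/seteqP; split => y /=; rewrite !in_itv /= !andbT; first by case.
  by move=> xy; split => //; rewrite (le_trans (ltW x0)) // ltW.
rewrite mulrC EFinM fineK ?ge0_fin_numE //.
have xr : 0 < x `^ r by exact: powR_gt0.
have mg : measurable_fun (`[0, +oo[ : set R) (fun y => (y `^ r * rho y)%:E).
  apply/measurable_EFinP; apply: measurable_funM => //.
  by apply: measurable_funTS; exact: measurable_powR.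
have sub : (`]x, +oo[ : set R) `<=` `[0, +oo[.
  move=> y /=; rewrite !in_itv /= !andbT => xy; exact: ltW (lt_trans x0 xy).
rewrite -ge0_integralZl //; first last.
- by rewrite lee_fin invr_ge0 ltW.
- by move=> y /=; rewrite in_itv /= andbT; exact: g0.
apply: (@le_trans _ _ (\int[mu]_(y in `]x, +oo[) ((x `^ r)^-1%:E * (y `^ r * rho y)%:E))%E).
  apply: ge0_le_integral => //.
  - by move=> y /sub /=; rewrite in_itv /= andbT => y0; rewrite lee_fin rho_ge0.
  - by apply/measurable_EFinP; apply: measurable_funS mrho.
  - apply/measurable_funeM; exact: measurable_funS mg.
  - move=> y /= xy; have := sub _ xy; move: xy; rewrite /= !in_itv /= !andbT => xy y0.
    rewrite -EFinM lee_fin mulrA ler_peMl ?rho_ge0 // mulrC ler_pdivlMr // mul1r.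
    by apply: ge0_ler_powR => //; rewrite ?nnegrE ltW // (le_trans _ xy) ?ltW.
apply: ge0_subset_integral => //.
  exact/measurable_funeM.
by move=> y /=; rewrite in_itv /= andbT => y0; rewrite mule_ge0 ?g0 // lee_fin invr_ge0 ltW.
Qed.

End random_variable.

End distribution_function.

(** * Partial fractions of the cosecant *)

Section fejer.
Context {R : realType}.
Implicit Types (a c t x : R) (j k m : nat).

Lemma is_derive_fsum (f df : nat -> R -> R) j x :
  (forall k, is_derive x 1 (f k) (df k x)) ->
  is_derive x 1 (fun t => \sum_(k < j) f k t) (\sum_(k < j) df k x).
Proof.
move=> H; elim: j => [|j IH].
  rewrite big_ord0 (_ : (fun t => _) = cst 0); first exact: is_derive_cst.
  by apply/funext => t; rewrite big_ord0.
rewrite big_ord_recr (_ : (fun t => _) = (fun t => \sum_(k < j) f k t) + f j).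
  exact: is_deriveD.
by apply/funext => t; rewrite big_ord_recr.
Qed.

Lemma is_derive_sinM c x : c != 0 ->
  is_derive x 1 (fun t => sin (c * t) / c) (cos (c * x)).
Proof.
move=> c0.
have H : is_derive x 1 (fun t => c * t) c.
  have := is_deriveZ c (is_derive_id x (1 : R)); rewrite /GRing.scale /= mulr1; exact.
have H2 := is_derive1_comp (f := sin) (is_derive_sin (c * x)) H.
rewrite (_ : (fun t => _) = c^-1 *: (sin \o (fun t => c * t))); last first.
  by apply/funext => t; rewrite /= mulrC.
apply: is_derive_eq; rewrite /GRing.scale /=; field; exact: c0.
Qed.

(** The Dirichlet kernel. *)
Definition dirichlet j t : R := 1 + \sum_(k < j) 2 * cos (k.+1%:R * t).

(** A primitive of the Dirichlet kernel. *)
Definition dirichlet_prim j t : R := t + \sum_(k < j) 2 * (sin (k.+1%:R * t) / k.+1%:R).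

(** A primitive of [cos (a * t) * dirichlet j t]. *)
Definition cos_dirichlet_prim a j t : R := sin (a * t) / a +
  \sum_(k < j) (sin ((a + k.+1%:R) * t) / (a + k.+1%:R) +
                sin ((a - k.+1%:R) * t) / (a - k.+1%:R)).

Lemma is_derive_dirichlet_prim j x : is_derive x 1 (dirichlet_prim j) (dirichlet j x).
Proof.
rewrite (_ : dirichlet_prim j =
  id + (fun t => \sum_(k < j) 2 * (sin (k.+1%:R * t) / k.+1%:R))) //.
apply: is_deriveD.
apply: (is_derive_fsum (f := fun k t => 2 * (sin (k.+1%:R * t) / k.+1%:R))
  (df := fun k t => 2 * cos (k.+1%:R * t))) => k.
have := @is_derive_sinM k.+1%:R x (lt0r_neq0 (ltr0Sn _ _)).
exact: is_deriveZ.
Qed.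

Lemma is_derive_cos_dirichlet_prim a j x : 0 < a < 1 ->
  is_derive x 1 (cos_dirichlet_prim a j) (cos (a * x) * dirichlet j x).
Proof.
move=> /andP[a0 a1].
have -> : cos (a * x) * dirichlet j x = cos (a * x) + \sum_(k < j)
    (cos ((a + k.+1%:R) * x) + cos ((a - k.+1%:R) * x)).
  rewrite /dirichlet mulrDr mulr1 mulr_sumr; congr (_ + _); apply: eq_bigr => k _.
  by rewrite (mulrBl x a) (mulrDl a k.+1%:R x) cosB cosD; ring.
have k1 k : 1 <= k.+1%:R :> R by rewrite ler1n.
rewrite (_ : cos_dirichlet_prim a j = (fun t => sin (a * t) / a) + (fun t =>
  \sum_(k < j) (sin ((a + k.+1%:R) * t) / (a + k.+1%:R) +
                sin ((a - k.+1%:R) * t) / (a - k.+1%:R)))) //.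
apply: is_deriveD; first by apply: is_derive_sinM; rewrite lt0r_neq0.
apply: (is_derive_fsum (f := fun k t => sin ((a + k.+1%:R) * t) / (a + k.+1%:R) +
                sin ((a - k.+1%:R) * t) / (a - k.+1%:R))
  (df := fun k t => cos ((a + k.+1%:R) * t) + cos ((a - k.+1%:R) * t))) => k.
by apply: is_deriveD; apply: is_derive_sinM; have := k1 k; [apply: contraTneq|
  apply: contraTneq] => E; rewrite -ltNge; lra.
Qed.

Lemma dirichletE j t : (1 - cos t) * dirichlet j t = cos (j%:R * t) - cos (j.+1%:R * t).
Proof.
elim: j => [|j IH]; first by rewrite /dirichlet big_ord0 addr0 mulr1 mul0r cos0 mul1r.
have -> : dirichlet j.+1 t = dirichlet j t + 2 * cos (j.+1%:R * t).
  by rewrite /dirichlet big_ord_recr addrA.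
rewrite mulrDr IH -[j.+2%:R]natr1 -[j.+1%:R]natr1 !mulrDl !mul1r !cosD sinD.
apply/eqP; rewrite -subr_eq0 [X in X == _](_ : _ =
  cos (j%:R * t) * (1 - (cos t ^+ 2 + sin t ^+ 2))); last by ring.
by rewrite cos2Dsin2 subrr mulr0.
Qed.

(** Up to the factor [1 - cos t], the sum of the Dirichlet kernels is the
    nonnegative Fejer kernel. *)
Lemma fejerE m t : (1 - cos t) * (\sum_(j < m) dirichlet j t) = 1 - cos (m%:R * t).
Proof.
rewrite mulr_sumr; under eq_bigr do rewrite dirichletE.
elim: m => [|m IH]; first by rewrite big_ord0 mul0r cos0 subrr.
by rewrite big_ord_recr /= IH addrA subrK.
Qed.

Lemma sin_shift_pi a k : sin ((a + k%:R) * pi) = (-1) ^+ k * sin (a * pi).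
Proof.
elim: k => [|k IH]; first by rewrite addr0 mul1r.
by rewrite -natr1 addrA mulrDl mul1r sinDpi IH exprS mulN1r mulNr.
Qed.

Lemma sin_shift_piN a k : sin ((a - k%:R) * pi) = (-1) ^+ k * sin (a * pi).
Proof.
have := sin_shift_pi (a - k%:R) k; rewrite subrK => ->.
by rewrite mulrA -exprMn mulrNN mulr1 expr1n mul1r.
Qed.

(** The symmetric partial sums of the partial fraction expansion of
    [pi / sin (pi * a)]. *)
Definition csc_sum a j : R := a^-1 +
  \sum_(k < j) (-1) ^+ k.+1 * ((a + k.+1%:R)^-1 + (a - k.+1%:R)^-1).

Lemma cos_dirichlet_prim_pi a j : cos_dirichlet_prim a j pi = sin (a * pi) * csc_sum a j.
Proof.
rewrite /cos_dirichlet_prim /csc_sum [RHS]mulrDr; congr (_ + _).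
rewrite mulr_sumr; apply: eq_bigr => k _.
by rewrite sin_shift_pi sin_shift_piN; ring.
Qed.

Lemma dirichlet_prim_pi j : dirichlet_prim j pi = pi.
Proof.
rewrite /dirichlet_prim big1 ?addr0 // => k _.
by rewrite -[k.+1%:R]add0r sin_shift_pi mul0r sin0 mulr0 mul0r mulr0.
Qed.

Lemma ndecr_0pi (f f' : R -> R) : (forall x, is_derive x 1 f (f' x)) ->
  (forall x, 0 < x < pi -> 0 <= f' x) -> f 0 <= f pi.
Proof.
move=> ff' f'0; have pi0 : 0 <= pi :> R by exact: pi_ge0.
have df x : derivable f x 1 by have := ff' x; case.
apply: (@ger0_derive1_ndecr _ f 0 pi (fun x _ => df x) _ _ _ _ (lexx 0) pi0 (lexx pi)).
  move=> x; rewrite in_itv /= => x0.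
  by rewrite derive1E (@derive_val _ _ _ _ _ _ _ (ff' x)) f'0.
apply: continuous_subspaceT => x.
exact/differentiable_continuous/derivable1_diffP.
Qed.

(** The Cesaro means of [sin (a * pi) * csc_sum a j] tend to [pi]. With [K] the sum
    of the first [m] Dirichlet kernels, the difference below is, up to the sign,
    the integral of [(1 - cos (a * t)) * K t] over [0, pi]; as
    [0 <= 1 - cos (a * t) <= 1 - cos t], it lies between 0 and the integral of
    [1 - cos (m * t)], which is [pi]. The integrals are avoided by comparing
    primitives. *)
Lemma cesaro_csc_sum a m : 0 < a < 1 ->
  `|\sum_(j < m) sin (a * pi) * csc_sum a j - m%:R * pi| <= pi.
Proof.
move=> a01; have /andP[a0 a1] := a01.
pose K t := \sum_(j < m) dirichlet j t.
pose H t := \sum_(j < m) (dirichlet_prim j t - cos_dirichlet_prim a j t).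
have dH x : is_derive x 1 H ((1 - cos (a * x)) * K x).
  rewrite mulr_sumr; apply: (is_derive_fsum
    (f := fun j t => dirichlet_prim j t - cos_dirichlet_prim a j t)
    (df := fun j t => (1 - cos (a * t)) * dirichlet j t)) => j.
  rewrite mulrBl mul1r; apply: is_deriveB; first exact: is_derive_dirichlet_prim.
  exact: is_derive_cos_dirichlet_prim.
have H0 : H 0 = 0.
  rewrite /H big1 // => j _; rewrite /dirichlet_prim /cos_dirichlet_prim.
  by rewrite !mulr0 sin0 !big1 ?mul0r ?addr0 ?subrr // => k _;
    rewrite !mulr0 sin0 !mul0r ?mulr0 ?addr0.
have Hpi : H pi = m%:R * pi - \sum_(j < m) sin (a * pi) * csc_sum a j.
  rewrite /H sumrB; congr (_ - _).
    under eq_bigr do rewrite dirichlet_prim_pi.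
    by rewrite sumr_const card_ord mulr_natl.
  by apply: eq_bigr => j _; rewrite cos_dirichlet_prim_pi.
have K0 x : 0 < x < pi -> 0 <= K x.
  move=> /andP[x0 xp].
  (* The Fejer kernel is nonnegative where [1 - cos x] is positive. *)
have c1 : 0 < 1 - cos x.
    rewrite subr_gt0 -[ltRHS]cos0 ltr_cos // in_itv /= ?lexx ?pi_ge0 ?ltW //.
  by rewrite -(pmulr_rge0 _ c1) fejerE subr_ge0 cos_le1.
have Hlo : 0 <= H pi.
  rewrite -H0; apply: ndecr_0pi dH _ => x xp.
  by rewrite mulr_ge0 ?K0 // subr_ge0 cos_le1.
have [->|m0] := eqVneq m 0%N.
  by rewrite big_ord0 mul0r subrr normr0 pi_ge0.
have mR : m%:R != 0 :> R by rewrite pnatr_eq0.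
(* [G] is a primitive of [(cos (a * t) - cos t) * K t]. *)
pose G t := t - sin (m%:R * t) / m%:R - H t.
have dG x : is_derive x 1 G (1 - cos (m%:R * x) - (1 - cos (a * x)) * K x).
  by apply: is_deriveB; apply: is_deriveB; exact: is_derive_sinM.
have Ghi : G 0 <= G pi.
  apply: ndecr_0pi dG _ => x xp; rewrite -fejerE -mulrBl mulr_ge0 ?K0 //.
  have /andP[x0 xpi] := xp.
  have -> : 1 - cos x - (1 - cos (a * x)) = cos (a * x) - cos x by ring.
  rewrite subr_ge0 ltW // ltr_cos ?in_itv /=.
  - by rewrite -[ltRHS]mul1r ltr_pM2r.
  - apply/andP; split; first by apply: mulr_ge0; exact: ltW.
    by apply: le_trans (ltW xpi); apply: ler_piMl; exact: ltW.
  - by apply/andP; split; exact: ltW.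
have sinm : sin (m%:R * pi) = 0 :> R.
  by rewrite -[m%:R]add0r sin_shift_pi mul0r sin0 mulr0.
move: Ghi; rewrite /G H0 mulr0 sin0 sinm mul0r !subr0 subr_ge0 => Ghi.
by rewrite distrC -Hpi ger0_norm.
Qed.

End fejer.

(** * The integral of 1 / (1 + x ^ b) *)

Section cosecant_integral.
Context {R : realType}.
Notation mu := (@lebesgue_measure R).

(** If the partial fractions converge at all, their sum is read off the Cesaro
    means. *)
Lemma cvg_csc_sum (a l : R) : 0 < a < 1 ->
  csc_sum a j @[j --> \oo] --> l -> sin (a * pi) * l = pi.
Proof.
move=> a01 al.
pose u j := sin (a * pi) * csc_sum a j.
have ul : u @ \oo --> sin (a * pi) * l by apply: cvgM => //; exact: cvg_cst.
apply: (cvg_unique _ (cesaro ul)) => //.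
apply/cvgrPdist_lt => e e0; near=> n.
rewrite /arithmetic_mean /= distrC.
have n0 : 0 < n.+1%:R :> R by rewrite ltr0n.
rewrite seriesEord /= -[X in _ - X](mulKf (lt0r_neq0 n0)) -mulrBr normrM.
rewrite ger0_norm ?invr_ge0 ?ltW //.
apply: (@le_lt_trans _ _ (n.+1%:R^-1 * pi)).
  by rewrite ler_pM2l ?invr_gt0 // /u cesaro_csc_sum.
rewrite mulrC ltr_pdivrMr // mulrC -ltr_pdivrMr //.
apply: (@le_lt_trans _ _ n%:R); last by rewrite ltr_nat.
by near: n; exact: nbhs_infty_ger.
Unshelve. all: by end_near. Qed.

(** Expansion of [1 / (1 + q)] in powers of [- q] under an integral: with [J k]
    the integral of [w * q ^ k / (1 + q)], one has [J k + J k.+1 = m k] and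
    [0 <= J k <= m k]. *)
Lemma alternating_integral (D : set R) (q w : R -> R) (m : nat -> R) :
  measurable D -> measurable_fun D q -> measurable_fun D w ->
  (forall x, D x -> 0 <= q x) -> (forall x, D x -> 0 <= w x) ->
  (forall k, (\int[mu]_(x in D) (w x * q x ^+ k)%:E = (m k)%:E)%E) ->
  m @ \oo --> (0 : R) ->
  exists2 J : R, (\int[mu]_(x in D) (w x / (1 + q x))%:E = J%:E)%E &
    \sum_(k < n) (-1) ^+ k * m k @[n --> \oo] --> J.
Proof.
move=> mD mq mw q0 w0 mE m0.
have mI k : measurable_fun D (fun x => (w x * q x ^+ k / (1 + q x))%:E).
  apply/measurable_EFinP; apply: measurable_funM.
    by apply: measurable_funM => //; exact: measurable_funX.
  apply: (@measurable_comp _ _ _ _ _ _ [set y : R | y != 0] (fun y => y^-1)).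
  - by apply: open_measurable; exact: open_neq.
  - by move=> y [x Dx <-] /=; rewrite lt0r_neq0 // ltr_pwDl // q0.
  - apply: open_continuous_measurable_fun; first exact: open_neq.
    by move=> y; rewrite inE /= => y0; exact: inv_continuous.
  - by apply: measurable_funD => //; exact: measurable_cst.
pose I k := (\int[mu]_(x in D) (w x * q x ^+ k / (1 + q x))%:E)%E.
have nn k x : D x -> (0 <= (w x * q x ^+ k / (1 + q x))%:E)%E.
  move=> Dx; have qx := q0 x Dx; have wx := w0 x Dx.
  by rewrite lee_fin divr_ge0 ?mulr_ge0 ?exprn_ge0 ?addr_ge0.
have I0 k : (0 <= I k)%E by apply: integral_ge0; exact: nn.
have IS k : (I k + I k.+1 = (m k)%:E)%E.
  rewrite -mE /I -ge0_integralD //; [|exact: nn|exact: mI|exact: nn|exact: mI].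
  apply: eq_integral => x; rewrite inE => Dx; rewrite -EFinD; congr EFin.
  by rewrite exprS; have := q0 x Dx => qx; field; rewrite lt0r_neq0 // ltr_pwDl.
have Ifin k : I k \is a fin_num.
  rewrite ge0_fin_numE //; apply: le_lt_trans (ltry (m k)); rewrite -IS.
  exact: leeDl.
pose J k := fine (I k).
have JS k : J k + J k.+1 = m k.
  by apply: EFin_inj; rewrite EFinD !fineK.
have J0 k : 0 <= J k by exact: fine_ge0.
exists (J 0%N).
  rewrite fineK // /I; apply: eq_integral => x _; by rewrite expr0 mulr1.
have SE n : \sum_(k < n) (-1) ^+ k * m k = J 0%N - (-1) ^+ n * J n.
  elim: n => [|n IH]; first by rewrite big_ord0 mul1r subrr.
  by rewrite big_ord_recr /= IH -JS exprS; ring.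
apply/cvgrPdist_le => e e0.
have := m0 => /cvgrPdist_le/(_ e e0); apply: filterS => n.
rewrite sub0r normrN SE opprB addrC subrK normrM normrX normrN1 expr1n mul1r.
apply: le_trans; rewrite ger0_norm // ger0_norm -?JS ?addr_ge0 //.
by rewrite lerDl.
Qed.

Lemma within_continuous_powR01 (c : R) : 0 <= c ->
  {within `[0, 1], continuous (fun x : R => x `^ c)}.
Proof.
rewrite le_eqVlt => /predU1P[<-|c0].
  rewrite (_ : (fun x : R => _) = cst 1); last by apply/funext => x; rewrite powRr0.
  by apply: continuous_subspaceT => x; exact: cvg_cst.
apply/(continuous_within_itvP _ ltr01); split.
- by move=> x; rewrite in_itv /= => /andP[x0 _]; exact: continuous_powR.
- by rewrite powR0 ?gt_eqF //; exact: powR_cvg0.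
- by apply: cvg_at_left_filter; exact: continuous_powR.
Qed.

Lemma integral_powR01 (c : R) : 0 <= c ->
  (\int[mu]_(x in `[0%R, 1%R]) (x `^ c)%:E = ((c + 1)^-1)%:E)%E.
Proof.
move=> c0.
have c1 : 0 < c + 1 by rewrite ltr_wpDl.
rewrite (@continuous_FTC2 _ _ (fun x => (c + 1)^-1 * x `^ (c + 1))) ?ltr01 //.
- by rewrite powR1 mulr1 powR0 ?gt_eqF // mulr0 sube0.
- exact: within_continuous_powR01.
- split => [x||].
  + rewrite in_itv /= => /andP[x0 _]; apply: derivableM; first exact: derivable_cst.
    by apply: derivable_powR; rewrite in_itv /= x0.
  + by apply: cvgM; [exact: cvg_cst | rewrite powR0 ?gt_eqF //; exact: powR_cvg0].
  + apply: cvgM; first exact: cvg_cst.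
    by apply: cvg_at_left_filter; exact: continuous_powR.
- move=> x; rewrite in_itv /= => /andP[x0 _].
  have xi : x \in `]0, +oo[%R by rewrite in_itv /= x0.
  rewrite derive1Ml; last by apply: derivable_powR.
  by rewrite powR_derive1 // addrK mulrA mulVf ?mul1r // gt_eqF.
Qed.

Lemma cvg_powR_pinfty (e : R) : 0 < e -> x `^ (- e) @[x --> +oo] --> (0 : R).
Proof.
move=> e0; apply/cvgrPdist_le => eps eps0; near=> x.
have x1 : eps^-1 `^ e^-1 <= x by near: x; exact: nbhs_pinfty_ge.
have x0 : 0 < x by apply: lt_le_trans x1; rewrite powR_gt0 ?invr_gt0.
rewrite sub0r normrN ger0_norm ?powR_ge0 // powRN -[leRHS]invrK.
rewrite lef_pV2 ?posrE ?powR_gt0 ?invr_gt0 //.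
have := @ge0_ler_powR _ e (ltW e0) (eps^-1 `^ e^-1) x.
rewrite !nnegrE powR_ge0 ltW // => /(_ isT isT x1).
by rewrite -powRrM mulVf ?gt_eqF // powRr1 // invr_ge0 ltW.
Unshelve. all: by end_near. Qed.

Lemma integral_powR1y (c : R) : 1 < c ->
  (\int[mu]_(x in `[1%R, +oo[) (x `^ (- c))%:E = ((c - 1)^-1)%:E)%E.
Proof.
move=> c1.
have c0 : 0 < c - 1 by rewrite subr_gt0.
rewrite (@ge0_continuous_FTC2y _ _ (fun x => - (c - 1)^-1 * x `^ (- (c - 1))) _ 0).
- by rewrite powR1 mulr1 -EFinB sub0r opprK.
- by move=> x _; exact: powR_ge0.
- apply: continuous_in_subspaceT => x; rewrite inE /= in_itv /= andbT => x1.
  by apply: continuous_powR; exact: lt_le_trans x1.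
- rewrite -[X in _ --> X](mulr0 (- (c - 1)^-1)).
  by apply: cvgM; [exact: cvg_cst | exact: cvg_powR_pinfty].
- move=> x x1; apply: derivableM; first exact: derivable_cst.
  by apply: derivable_powR; rewrite in_itv /= (lt_trans ltr01 x1).
- apply: cvgM; first exact: cvg_cst.
  by apply: cvg_at_right_filter; exact: continuous_powR.
- move=> x; rewrite in_itv /= andbT => x1.
  have xi : x \in `]0, +oo[%R by rewrite in_itv /= (lt_trans ltr01 x1).
  rewrite derive1Ml; last by apply: derivable_powR.
  rewrite powR_derive1 // mulrA mulrNN mulVf ?gt_eqF // mul1r.
  by congr (_ `^ _); ring.
Qed.

Lemma measurable_inv_powR (b : R) (D : set R) : measurable D ->
  measurable_fun D (fun x : R => (1 + x `^ b)^-1).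
Proof.
move=> mD; apply: (@measurable_comp _ _ _ _ _ _ [set y : R | y != 0] (fun y => y^-1)).
- by apply: open_measurable; exact: open_neq.
- by move=> y [x Dx <-] /=; rewrite lt0r_neq0 // ltr_pwDl // powR_ge0.
- apply: open_continuous_measurable_fun; first exact: open_neq.
  by move=> y; rewrite inE /= => y0; exact: inv_continuous.
- apply: measurable_funD; first exact: measurable_cst.
  by apply: measurable_funTS; exact: measurable_powR.
Qed.

(** The expansion in powers of [x ^ b] on [0, 1] and of [x ^ (- b)] on
    [1, +oo) yields the partial fractions of the cosecant. *)
Theorem integral_inv_powR (b : R) : 1 < b ->
  (\int[mu]_(x in `[0%R, +oo[) ((1 + x `^ b)^-1)%:E =
     (pi / (b * sin (pi / b)))%:E)%E.
Proof.
move=> b1; have b0 : 0 < b by exact: lt_trans b1.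
have bk k : 0 < b * k%:R + 1 by rewrite ltr_wpDl // mulr_ge0 ?(ltW b0).
have bk' k : 0 < b * k.+1%:R - 1.
  rewrite subr_gt0 (lt_le_trans b1) // ler_peMr ?(ltW b0) // ler1n //.
have cvgm (c : R) : (b * n%:R + c)^-1 @[n --> \oo] --> (0 : R).
  apply/cvgrPdist_le => e e0; near=> n.
  have n1 : (e^-1 - c) / b <= n%:R by near: n; exact: nbhs_infty_ger.
  have H : e^-1 <= b * n%:R + c by move: n1; rewrite ler_pdivrMr // mulrC; lra.
  have ei : 0 < e^-1 by rewrite invr_gt0.
  have H0 : 0 < b * n%:R + c by exact: lt_le_trans H.
  by rewrite sub0r normrN ger0_norm ?invr_ge0 ?(ltW H0) // -[leRHS]invrK lef_pV2 ?posrE.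
have [J1 J1E J1c] : exists2 J : R,
    (\int[mu]_(x in `[0%R, 1%R]) (1 / (1 + x `^ b))%:E = J%:E)%E &
    \sum_(k < n) (-1) ^+ k * (b * k%:R + 1)^-1 @[n --> \oo] --> J.
  apply: (@alternating_integral _ (fun x => x `^ b) (fun=> 1)
    (fun k => (b * k%:R + 1)^-1)) => //.
  - by apply: measurable_funTS; exact: measurable_powR.
  - by move=> x _; exact: powR_ge0.
  - move=> k; rewrite -integral_powR01 ?mulr_ge0 ?(ltW b0) //.
    by apply: eq_integral => x _; rewrite mul1r powRrM powR_mulrn // powR_ge0.
have [J2 J2E J2c] : exists2 J : R,
    (\int[mu]_(x in `[1%R, +oo[) (x `^ (- b) / (1 + x `^ (- b)))%:E = J%:E)%E &
    \sum_(k < n) (-1) ^+ k * (b * k.+1%:R - 1)^-1 @[n --> \oo] --> J.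
  apply: (@alternating_integral _ (fun x => x `^ (- b)) (fun x => x `^ (- b))
     (fun k => (b * k.+1%:R - 1)^-1)) => //.
  - by apply: measurable_funTS; exact: measurable_powR.
  - by apply: measurable_funTS; exact: measurable_powR.
  - by move=> x _; exact: powR_ge0.
  - by move=> x _; exact: powR_ge0.
  - move=> k; rewrite -integral_powR1y; last by move: (bk' k); lra.
    apply: eq_integral => x _; rewrite -exprS -powR_mulrn ?powR_ge0 //.
    by rewrite -powRrM mulNr.
  - rewrite (_ : (fun k => _) = (fun k => (b * k%:R + (b - 1))^-1)) //.
    by apply/funext => k; rewrite -natr1; congr (_^-1); ring.
have a01 : 0 < b^-1 < 1 by rewrite invr_gt0 b0 invf_lt1.
have Jc : csc_sum b^-1 n @[n --> \oo] --> b * (J1 + J2).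
  pose S n := \sum_(k < n) (-1) ^+ k * (b * k%:R + 1)^-1 +
    \sum_(k < n) (-1) ^+ k * (b * k.+1%:R - 1)^-1.
  (* The partial sums differ by one term, which tends to 0. *)
have SE n : csc_sum b^-1 n = b * (S n + (-1) ^+ n * (b * n%:R + 1)^-1).
    elim: n => [|n IH].
      by rewrite /csc_sum /S !big_ord0 !addr0 mulr0 !add0r invr1 mul1r mulr1 invrK.
    rewrite /csc_sum big_ord_recr addrA -/(csc_sum _ n) IH /S !big_ord_recr /=.
    have E1 : (b^-1 + n.+1%:R)^-1 = b * (b * n.+1%:R + 1)^-1.
      rewrite (_ : b^-1 + _ = (b * n.+1%:R + 1) / b) ?invf_div //.
      by field; rewrite gt_eqF.
    have E2 : (b^-1 - n.+1%:R)^-1 = - (b * (b * n.+1%:R - 1)^-1).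
      rewrite (_ : b^-1 - _ = - ((b * n.+1%:R - 1) / b)) ?invrN ?invf_div //.
      by field; rewrite gt_eqF.
    by rewrite E1 E2 exprS; ring.
  under eq_fun do rewrite SE.
  apply: cvgM; first exact: cvg_cst.
  rewrite -[X in _ --> X]addr0; apply: cvgD; first exact: cvgD.
  apply/cvgrPdist_le => e e0; have := cvgm 1 => /cvgrPdist_le/(_ e e0).
  apply: filterS => n; rewrite !sub0r !normrN normrM normrX normrN1 expr1n mul1r //.
have := cvg_csc_sum a01 Jc; rewrite [b^-1 * pi]mulrC => piE.
have s0 : 0 < sin (pi / b).
  apply: sin_gt0_pi; rewrite divr_gt0 ?pi_gt0 //= ltr_pdivrMr // ltr_pMr ?pi_gt0 //.
have -> : pi / (b * sin (pi / b)) = J1 + J2.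
  by rewrite -[X in X / _]piE; field; rewrite !gt_eqF.
rewrite EFinD -J1E -J2E.
have -> : `[0, +oo[%classic = `[0, 1] `|` `]1, +oo[ :> set R.
  by rewrite -itv_bndbnd_setU ?bnd_simp.
have mI (D : set R) : measurable D -> measurable_fun D (fun x : R => ((1 + x `^ b)^-1)%:E).
  by move=> mD; apply/measurable_EFinP; exact: measurable_inv_powR.
rewrite ge0_integral_setU //=.
- congr (_ + _)%E; first by apply: eq_integral => x _; rewrite div1r.
  rewrite integral_itv_obnd_cbnd; last exact: mI.
  apply: eq_integral => x; rewrite inE /= in_itv /= andbT => x1.
  have xb : 0 < x `^ b by rewrite powR_gt0 // (lt_le_trans ltr01 x1).
  rewrite powRN; congr EFin; field; rewrite !gt_eqF // addr_gt0 //.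
- by apply: mI; exact: measurableU.
- by move=> x _; rewrite lee_fin invr_ge0 addr_ge0 // powR_ge0.
- by apply/disj_setPS => x /=; rewrite !in_itv /= andbT => -[/andP[_ x1]]; rewrite ltNge x1.
Unshelve. all: by end_near. Qed.

End cosecant_integral.

(** * Scaling limits *)

Section scaling.
Context (R : realType) (d : R) (rho : R -> R).
Hypothesis d_gt0 : 0 < d.
Hypothesis rho_density : is_density rho.
Hypothesis rho_near0 : rho x / (d * x `^ (d - 1)) @[x --> 0^'+] --> (1 : R).

(** The factor [N ^ (1 / d)] for the graph with [N = n.+1] vertices a side. *)
Definition scale (n : nat) : R := n.+1%:R `^ d^-1.

Lemma scale_gt0 n : 0 < scale n.
Proof. by rewrite powR_gt0. Qed.

Lemma scaleX n : scale n `^ d = n.+1%:R.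
Proof. by rewrite -powRrM mulVf ?gt_eqF // powRr1. Qed.

Lemma powR_scaled n z : 0 <= z -> (z / scale n) `^ d = z `^ d / n.+1%:R.
Proof.
move=> z0; rewrite powRM // ?invr_ge0 ?(ltW (scale_gt0 n)) //; congr (_ * _).
by rewrite -powR_inv1 ?(ltW (scale_gt0 n)) // powRAC scaleX powR_inv1.
Qed.

Lemma near_scaled_lt z delta : 0 <= z -> 0 < delta ->
  \forall n \near \oo, z / scale n < delta.
Proof.
move=> z0 d0; near=> n.
rewrite ltr_pdivrMr ?scale_gt0 // mulrC -ltr_pdivrMr //.
have zd : 0 <= z / delta by rewrite divr_ge0 // ltW.
rewrite -[ltLHS]powRr1 // -(mulfV (lt0r_neq0 d_gt0)) powRrM.
apply: gt0_ltr_powR; rewrite ?invr_gt0 ?nnegrE ?powR_ge0 //.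
apply: (@le_lt_trans _ _ n%:R); last by rewrite ltr_nat.
by near: n; exact: nbhs_infty_ger.
Unshelve. all: by end_near. Qed.

(** The expected number of edges at a given vertex of cost below
    [z / scale n] tends to [z ^ d]. *)
Lemma scaled_cdf_cvg z : 0 <= z ->
  n.+1%:R * dcdf rho (z / scale n) @[n --> \oo] --> z `^ d.
Proof.
move=> z0; apply/cvgrPdist_le => e e0.
have zd0 : 0 <= z `^ d by exact: powR_ge0.
have zd1 : 0 < z `^ d + 1 by rewrite ltr_wpDl.
have [delta del0 H] := dcdf_near0 d_gt0 rho_density rho_near0 (divr_gt0 e0 zd1).
near=> n.
have n0 : 0 < n.+1%:R :> R by rewrite ltr0n.
have zs : 0 <= z / scale n < delta.
  rewrite divr_ge0 ?(ltW (scale_gt0 n)) //=.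
  by near: n; exact: near_scaled_lt.
have := H _ zs; rewrite powR_scaled // => /andP[l u].
have {}l : (1 - e / (z `^ d + 1)) * z `^ d <= n.+1%:R * dcdf rho (z / scale n).
  by rewrite [leRHS]mulrC -ler_pdivrMr // -mulrA.
have {}u : n.+1%:R * dcdf rho (z / scale n) <= (1 + e / (z `^ d + 1)) * z `^ d.
  by rewrite mulrC -ler_pdivlMr // -mulrA.
have ez : e / (z `^ d + 1) * z `^ d <= e.
  by rewrite -mulrA ler_piMr ?(ltW e0) // mulrC ler_pdivrMr // mul1r lerDl.
by rewrite ler_distl; move: l u; rewrite mulrBl mulrDl mul1r; lra.
Unshelve. all: by end_near. Qed.

Lemma scaled_cdf_cvg0 z : 0 <= z -> dcdf rho (z / scale n) @[n --> \oo] --> (0 : R).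
Proof.
move=> z0; rewrite -[X in _ --> X](mulr0 (z `^ d)).
rewrite (_ : (fun n => _) = (fun n => n.+1%:R * dcdf rho (z / scale n) * harmonic n)).
  by apply: cvgM; [exact: scaled_cdf_cvg | exact: cvg_harmonic].
by apply/funext => n; rewrite /harmonic /= [RHS]mulrC mulKf.
Qed.

Lemma tail_bound_cvg z : 0 <= z ->
  (1 + n.+1%:R * dcdf rho (z / scale n))^-1 @[n --> \oo] --> (1 + z `^ d)^-1.
Proof.
move=> z0; apply: cvgV; first by rewrite lt0r_neq0 // ltr_pwDl // powR_ge0.
by apply: cvgD; [exact: cvg_cst | exact: scaled_cdf_cvg].
Qed.

Lemma tail_lower_bound_cvg z : 0 <= z ->
  (1 - dcdf rho (z / scale n)) /
    (1 - dcdf rho (z / scale n) + n.+1%:R * dcdf rho (z / scale n)) - n.+1%:R^-1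
    @[n --> \oo] --> (1 + z `^ d)^-1.
Proof.
move=> z0; have c1 : 1 - dcdf rho (z / scale n) @[n --> \oo] --> (1 : R).
  rewrite -[X in _ --> X]subr0; apply: cvgB; [exact: cvg_cst | exact: scaled_cdf_cvg0].
rewrite -[X in _ --> X]subr0 -[X in _ --> X - _]mul1r.
apply: cvgB; last exact: cvg_harmonic.
apply: cvgM => //; apply: cvgV; first by rewrite lt0r_neq0 // ltr_pwDl // powR_ge0.
by apply: cvgD => //; exact: scaled_cdf_cvg.
Qed.

End scaling.

(** * Asymptotics of the stable cost *)

(** Layer cake formula. *)
Lemma integral_tail (R : realType) disp (T : measurableType disp)
    (P : probability T R) (f : T -> R) :
  measurable_fun setT f -> (forall t, 0 <= f t) ->
  (\int[P]_t (f t)%:E =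
   \int[lebesgue_measure]_(u in `[0%R, +oo[) P [set t | (u < f t)%R])%E /\
  measurable_fun (setT : set R) (fun u => P [set t | u < f t]).
Proof.
move=> mf f0; pose X : {RV P >-> R} := mfun_Sub (mem_set mf).
have cE u : ccdf X u = P [set t | u < f t].
  rewrite /ccdf; have -> : [set t | u < f t] = X @^-1` `]u, +oo[ by
    apply/seteqP; split => t /=; rewrite in_itv /= andbT.
  by [].
split; last first.
  rewrite (_ : (fun u => _) = ccdf X); first exact: ccdf_measurable.
  by apply/funext => u; rewrite cE.
transitivity ('E_P[X])%E; first by rewrite expectation_def.
rewrite ge0_expectation_ccdf //; by apply: eq_integral => u _; rewrite cE.
Qed.

Lemma interpolation (R : realType) (A x y tau : R) : 0 < tau < 1 ->
  0 <= A -> A <= x -> A <= y -> A <= x `^ (1 - tau) * y `^ tau.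
Proof.
move=> /andP[t0 t1]; rewrite le_eqVlt => /predU1P[<- _ _|A0 Ax Ay].
  by rewrite mulr_ge0 ?powR_ge0.
have tau1 : 0 <= 1 - tau by rewrite subr_ge0 ltW.
rewrite -[leLHS]powRr1 ?(ltW A0) // -[X in A `^ X](subrK tau).
rewrite powRD ?(gt_eqF A0) ?implybT //.
apply: ler_pM; rewrite ?powR_ge0 //; apply: ge0_ler_powR; rewrite ?nnegrE ?(ltW t0) ?(ltW A0) //;
  by apply: le_trans (ltW A0) _.
Qed.

Lemma powR_inv_lt (R : realType) (p u x : R) : 0 < p -> 0 <= u -> 0 <= x ->
  (u < x `^ p) = (u `^ p^-1 < x).
Proof.
move=> p0 u0 x0; have up : (u `^ p^-1) `^ p = u by rewrite -powRrM mulVf ?gt_eqF // powRr1.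
apply/idP/idP => H; last by rewrite -up gt0_ltr_powR ?nnegrE ?powR_ge0.
rewrite ltNge; apply: contraTN H => xu; rewrite -leNgt -up.
by apply: ge0_ler_powR; rewrite ?nnegrE ?powR_ge0 // ltW.
Qed.

Section stable_cost_asymptotics.
Context (R : realType) (d : R) (rho : R -> R)
  (disp : nat -> measure_display) (T : forall n, measurableType (disp n))
  (P : forall n, probability (T n) R)
  (omega : forall n, 'I_n.+1 * 'I_n.+1 -> {RV (P n) >-> R})
  (v : forall n, 'I_n.+1).
Hypotheses (d_gt0 : 0 < d) (rho_density : is_density rho).
Hypothesis rho_near0 : rho x / (d * x `^ (d - 1)) @[x --> 0^'+] --> (1 : R).
Hypothesis omega_indep : forall n, mutually_independent (@omega n).
Hypothesis omega_density : forall n e, has_density (@omega n e) rho.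

Let c n (t : T n) := stable_cost (fun u u' : 'I_n.+1 => @omega n (u, u') t) (v n).
Let F := dcdf rho.

Let cdfE n e x : P n [set t | @omega n e t <= x] = (F x)%:E.
Proof. exact: density_cdf. Qed.

Let quantE u : 0 < u < 1 -> exists s, F s = u.
Proof. exact: (density_quantile rho_density (@omega_density 0%N (ord0, ord0))). Qed.

Let F_mono x y : x <= y -> F x <= F y.
Proof. exact: (cdf_mono (v 0%N) (@cdfE 0%N)). Qed.

Let F_ge0 x : 0 <= F x.
Proof. exact: dcdf_ge0. Qed.

Let scale_gt0n n : 0 < scale d n.
Proof. exact: scale_gt0. Qed.

Lemma measurable_cost n : measurable_fun setT (@c n).
Proof. by apply: (measurable_stable_cost (X := fun e => @omega n e)) => e; exact: measurable_funPT. Qed.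

(** The tail of the rescaled cost. *)
Definition scaled_tail n (z : R) := P n [set t | (z%:E < (scale d n)%:E * c t)%E].

Lemma scaled_tailE n z :
  [set t | (z%:E < (scale d n)%:E * @c n t)%E] = [set t | ((z / scale d n)%:E < @c n t)%E].
Proof.
apply/seteqP; split => t /=; rewrite -lte_pdivrMl // -EFinM mulrC //.
Qed.

Lemma measurable_scaled_tail n z :
  measurable [set t | (z%:E < (scale d n)%:E * @c n t)%E].
Proof. by rewrite scaled_tailE; exact: measurable_cost_gt. Qed.

Lemma scaled_tail_fin n z : scaled_tail n z \is a fin_num.
Proof. by apply: fin_num_measure; exact: measurable_scaled_tail. Qed.

Lemma scaled_tail_le n z :
  (scaled_tail n z <= ((1 + n.+1%:R * F (z / scale d n))^-1)%:E)%E.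
Proof.
rewrite /scaled_tail scaled_tailE.
have := cost_tail_le (v n) (omega_indep (n := n)) (@cdfE n) quantE (z / scale d n).
by rewrite card_ord.
Qed.

Lemma scaled_tail_cvg z : 0 <= z ->
  (scaled_tail n z @[n --> \oo] --> ((1 + z `^ d)^-1)%:E)%E.
Proof.
move=> z0; apply: (@squeeze_cvge _ _ _ _
  (fun n => ((1 - F (z / scale d n)) /
    (1 - F (z / scale d n) + n.+1%:R * F (z / scale d n)) - n.+1%:R^-1)%:E) _
  (fun n => ((1 + n.+1%:R * F (z / scale d n))^-1)%:E)).
- near=> n; rewrite scaled_tail_le andbT.
  rewrite /scaled_tail scaled_tailE.
  have := cost_tail_ge (v n) (omega_indep (n := n)) (@cdfE n) quantE (x := z / scale d n).
  rewrite card_ord; apply.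
  by near: n; apply: (cvgr_lt _ (scaled_cdf_cvg0 d_gt0 rho_density rho_near0 z0)).
- by apply: cvg_EFin; [near=> n | exact: tail_lower_bound_cvg].
- by apply: cvg_EFin; [near=> n | exact: tail_bound_cvg].
Unshelve. all: by end_near. Qed.

Lemma prob_cost_lt0 n : P n [set t | (@c n t < 0)%E] = 0%E.
Proof.
apply/eqP; rewrite eq_le measure_ge0 andbT.
have mlt e : measurable [set t | @omega n e t < 0].
  rewrite (_ : [set t | _] = @omega n e @^-1` `]-oo, 0[).
    by rewrite -[X in measurable X]setTI; exact: measurable_funPT.
  by apply/seteqP; split => t /=; rewrite in_itv.
apply: (@le_trans _ _ (\sum_(e | predT e) P n [set t | (@omega n e t < 0)%R])%E).
  apply: measure_le_fin_sum => // [|t].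
    have := @measurable_cost n measurableT `]-oo, 0%E[%classic (emeasurable_itv _).
    by rewrite setTI; congr measurable; apply/seteqP; split => t /=; rewrite in_itv.
  rewrite /= /c /stable_cost /matching_costl; case: pickP => // u _.
  by rewrite lte_fin; exists (v n, u).
by rewrite big1 // => e _; exact: density_ge0_ae.
Qed.

Lemma prob_unmatched n : P n [set t | @c n t = +oo%E] = 0%E.
Proof. exact: unmatched_null (omega_indep (n := n)) (@cdfE n) quantE. Qed.

(** A large cost of a vertex forces one of its edges to have a large cost. *)
Lemma cost_tail_moment n r x : 0 <= r -> 0 < x ->
  (\int[lebesgue_measure]_(y in `[0%R, +oo[) (y `^ r * rho y)%:E < +oo)%E ->
  (P n [set t | (x%:E < @c n t)%E] <= (n.+1%:R *
    (fine (\int[lebesgue_measure]_(y in `[0%R, +oo[) (y `^ r * rho y)%:E) / x `^ r))%:E)%E.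
Proof.
move=> r0 x0 mom.
have mgt e : measurable [set t | x < @omega n e t].
  rewrite (_ : [set t | _] = @omega n e @^-1` `]x, +oo[).
    by rewrite -[X in measurable X]setTI; exact: measurable_funPT.
  by apply/seteqP; split => t /=; rewrite in_itv /= andbT.
have mU := measurable_unmatched (@omega n) (v n).
have mC := measurable_cost_gt (@omega n) (v n) x.
pose B u := [set t | x < @omega n (v n, u) t].
have H : (P n ([set t | (x%:E < @c n t)%E] `\` [set t | @c n t = +oo%E]) <=
    \sum_(u | predT u) P n (B u))%E.
  apply: measure_le_fin_sum; first exact: measurableD.
    by move=> u; exact: mgt.
  move=> t /= []; rewrite /c /stable_cost /matching_costl; case: pickP => // u _.
  by rewrite lte_fin => xu _; exists u.
apply: (@le_trans _ _ (P n ([set t | (x%:E < @c n t)%E] `\` [set t | @c n t = +oo%E]) +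
  P n [set t | @c n t = +oo%E])%E).
  apply: le_trans (measureU2 _ (measurableD mC mU) mU).
  apply: le_measure; rewrite ?in_setE; [exact: mC | by apply: measurableU => //; exact: measurableD |].
  by move=> t xc; case: (pselect (@c n t = +oo%E)) => [?|?]; [right | left].
rewrite prob_unmatched adde0; apply: le_trans H _.
apply: (@le_trans _ _ (\sum_(u < n.+1) (fine (\int[lebesgue_measure]_(y in `[0%R, +oo[)
    (y `^ r * rho y)%:E) / x `^ r)%:E)%E).
  by apply: lee_sum => u _; exact: density_tail.
by rewrite sumEFin sumr_const card_ord mulr_natl.
Qed.

(** A bound on the rescaled tails that is uniform in [n] and decays faster than
    [z ^ (- p)], namely like [z ^ (- q)] with [q = d * r / (2 * d + r)]. The
    hypothesis on [r] says exactly that [q > p]. *)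
Lemma scaled_tail_dominated p r : 0 < p < d -> 2 * d * p / (d - p) < r ->
  (\int[lebesgue_measure]_(y in `[0%R, +oo[) (y `^ r * rho y)%:E < +oo)%E ->
  exists C b : R, [/\ 0 <= C, 1 < b & forall n z, 0 <= z ->
    (scaled_tail n z <= (C / (1 + z `^ (p * b)))%:E)%E].
Proof.
move=> /andP[p0 pd] pr mom.
have dp : 0 < d - p by rewrite subr_gt0.
have r0 : 0 < r by apply: lt_trans pr; rewrite divr_gt0 // !mulr_gt0.
have dr : 0 < 2 * d + r by rewrite addr_gt0 // mulr_gt0.
pose tau := d / (2 * d + r); pose q := r * tau; pose b := q / p.
have tau0 : 0 < tau by rewrite divr_gt0.
have tau1 : tau < 1 by rewrite ltr_pdivrMr // mul1r; move: d_gt0 r0; lra.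
have b1 : 1 < b.
  rewrite /b ltr_pdivlMr // mul1r /q mulrA ltr_pdivlMr //.
  by move: pr; rewrite ltr_pdivrMr //; lra.
have pb : p * b = q by rewrite /b mulrC divfK // gt_eqF.
have q0 : 0 < q by rewrite mulr_gt0.
have qd : q <= d.
  rewrite /q mulrA ler_pdivrMr // mulrC ler_pM2l //; move: d_gt0 r0; lra.
set m := fine (\int[lebesgue_measure]_(y in `[0%R, +oo[) (y `^ r * rho y)%:E)%E.
have half0 : 0 < 2^-1 :> R by rewrite invr_gt0.
have [delta del0 H] := dcdf_near0 d_gt0 rho_density rho_near0 half0.
pose k1 := F (delta / 2).
have del2 : 0 < delta / 2 by rewrite divr_gt0.
have k10 : 0 < k1.
  have /H/andP[+ _] : 0 <= delta / 2 < delta.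
    by rewrite (ltW del2) /= ltr_pdivrMr // mulr_natr mulr2n ltrDl.
  by apply: lt_le_trans; rewrite mulr_gt0 ?powR_gt0 // subr_gt0 invf_lt1 // ltr1n.
pose C1 := (k1^-1) `^ (1 - tau) * m `^ tau.
have C10 : 0 <= C1 by rewrite mulr_ge0 ?powR_ge0.
exists (4 + 2 * C1), b; split => //; first by rewrite addr_ge0 // mulr_ge0.
move=> n z z0; rewrite pb -(fineK (scaled_tail_fin n z)) lee_fin.
set A := fine _.
have A0 : 0 <= A by apply: fine_ge0; exact: measure_ge0.
have Aub : A <= (1 + n.+1%:R * F (z / scale d n))^-1.
  by rewrite -lee_fin fineK ?scaled_tail_fin // scaled_tail_le.
have NF0 : 0 <= n.+1%:R * F (z / scale d n) by rewrite mulr_ge0.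
have A1 : A <= 1 by apply: le_trans Aub _; rewrite invf_le1 ?lerDl // ltr_pwDl.
have zq0 : 0 <= z `^ q by exact: powR_ge0.
have zq1 : 0 < 1 + z `^ q by rewrite ltr_pwDl.
rewrite ler_pdivlMr //.
have oneq : 1 `^ q = 1 by rewrite powR1.
have [z1|z1] := leP z 1.
  have zq : z `^ q <= 1.
    by rewrite -[leRHS]oneq; apply: ge0_ler_powR; rewrite ?nnegrE // ltW.
  apply: (@le_trans _ _ (1 * 2)); last by move: C10; lra.
  by apply: ler_pM => //; [exact: ltW | lra].
have zp : 0 < z by exact: lt_trans z1.
have zqge1 : 1 <= z `^ q.
  by rewrite -[leLHS]oneq; apply: ge0_ler_powR; rewrite ?nnegrE // ltW.
suff HA : A * z `^ q <= 2 + C1.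
  have : A * (1 + z `^ q) <= A * z `^ q + A * z `^ q.
    by rewrite mulrDr mulr1 lerD2r ler_peMr.
  by move: HA; lra.
have N0 : 0 < n.+1%:R :> R by rewrite ltr0n.
have s0 : 0 < z / scale d n by rewrite divr_gt0.
(* Near the origin, use the equivalent [x ^ d] of the distribution function. *)
have [sd|sd] := ltP (z / scale d n) delta.
  have /H/andP[+ _] : 0 <= z / scale d n < delta by rewrite ltW.
  rewrite powR_scaled // mulrA ler_pdivrMr // [X in _ <= X]mulrC -/F => NF.
  have zd0 : 0 < z `^ d by exact: powR_gt0.
  apply: (@le_trans _ _ (2 / z `^ d * z `^ d)); last by rewrite divfK ?gt_eqF //; lra.
  apply: ler_pM => //; last by apply: ler_powR => //; exact: ltW.
  apply: le_trans Aub _; rewrite -[leRHS]invf_div lef_pV2 ?posrE ?divr_gt0 //; last first.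
    by rewrite ltr_pwDl.
  by move: NF; lra.
(* Away from it, interpolate between two bounds with weights [1 - tau] and [tau]. *)
have Ax : A <= n.+1%:R^-1 * k1^-1.
  apply: le_trans Aub _; rewrite -invfM lef_pV2 ?posrE ?mulr_gt0 //; last by rewrite ltr_pwDl.
  apply: (@le_trans _ _ (n.+1%:R * F (z / scale d n))); last by rewrite lerDr.
  rewrite ler_pM2l // F_mono // (le_trans _ sd) //.
  by rewrite ler_pdivrMr // mulr_natr mulr2n lerDl ltW.
have Ay : A <= n.+1%:R * (m / (z / scale d n) `^ r).
  rewrite -lee_fin fineK ?scaled_tail_fin // /scaled_tail scaled_tailE.
  exact: (@cost_tail_moment n _ _ (ltW r0) s0 mom).
have m0 : 0 <= m.
  apply: fine_ge0; apply: integral_ge0 => y /=; rewrite in_itv /= andbT => y0.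
  by rewrite lee_fin mulr_ge0 ?powR_ge0 //; case: rho_density => _ + _; exact.
have tau01 : 0 < tau < 1 by rewrite tau0.
apply: (@le_trans _ _ (C1 * z `^ (- q) * z `^ q)); last first.
  by rewrite -mulrA -powRD ?(gt_eqF zp) ?implybT // addNr powRr0 mulr1 lerDr.
rewrite ler_wpM2r //; apply: le_trans (interpolation tau01 A0 Ax Ay) _.
have sV : ((z / scale d n) `^ r)^-1 `^ tau = z `^ (- q) * n.+1%:R `^ (q / d).
  rewrite -powRN -powRrM mulNr -/q powRM ?invr_ge0 ?(ltW (scale_gt0n n)) ?(ltW zp) //.
  congr (_ * _); rewrite -powR_inv1 ?(ltW (scale_gt0n n)) // -powRrM mulN1r opprK.
  by rewrite /scale -powRrM mulrC.
rewrite powRM ?invr_ge0 ?(ltW k10) ?(ltW N0) // powRM ?(ltW N0) //; last first.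
  by rewrite divr_ge0 // powR_ge0.
rewrite powRM ?invr_ge0 ?powR_ge0 // sV -[n.+1%:R^-1]powR_inv1 ?(ltW N0) // -powRrM.
(* The choice of [tau] makes the powers of [n.+1] cancel. *)
have NE : n.+1%:R `^ (-1 * (1 - tau)) * n.+1%:R `^ tau * n.+1%:R `^ (q / d) = 1 :> R.
  rewrite -!powRD ?(gt_eqF N0) ?implybT //.
  rewrite (_ : _ + _ = 0) ?powRr0 // /q /tau; field.
  by rewrite !gt_eqF.
rewrite /C1.
set x1 := _ `^ (-1 * _) in NE *; set x2 := _ `^ tau in NE *; set x3 := _ `^ (q / d) in NE *.
set y1 := _ `^ (1 - tau); set y2 := m `^ tau; set y3 := z `^ _.
rewrite (_ : _ * _ * _ = x1 * x2 * x3 * (y1 * y2 * y3)); last by ring.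
by rewrite NE mul1r.
Qed.

Section moment.
Variable p : R.
Hypothesis p_gt0 : 0 < p.

(** The rescaled cost to the power [p], made real and nonnegative on the null
    set where it is not. *)
Let Z n (t : T n) : R := (scale d n * Num.max 0 (fine (c t))) `^ p.

Let mZ n : measurable_fun setT (@Z n).
Proof.
apply: (measurableT_comp (measurable_powR p)).
apply: measurable_funM; first exact: measurable_cst.
apply: measurable_maxr; first exact: measurable_cst.
exact: (measurableT_comp (fine_measurable measurableT) (@measurable_cost n)).
Qed.

Let Z_ge0 n (t : T n) : 0 <= Z t.
Proof. exact: powR_ge0. Qed.

Let Z_tail n u : 0 <= u -> P n [set t | u < Z t] = scaled_tail n (u `^ p^-1).
Proof.
move=> u0.
have mZu : measurable [set t | u < @Z n t].
  rewrite (_ : [set t | _] = @Z n @^-1` `]u, +oo[).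
    by rewrite -[X in measurable X]setTI; exact: mZ.
  by apply/seteqP; split => t /=; rewrite in_itv /= andbT.
have mU := measurable_unmatched (@omega n) (v n).
have X0 (t : T n) : 0 <= scale d n * Num.max 0 (fine (c t)).
  by rewrite mulr_ge0 ?(ltW (scale_gt0n n)) // le_max lexx.
have w0 : 0 <= u `^ p^-1 by exact: powR_ge0.
apply/eqP; rewrite eq_le; apply/andP; split.
  apply: le_measure; rewrite ?in_setE //; first exact: measurable_scaled_tail.
  move=> t /=; rewrite /Z powR_inv_lt //.
  have [y0|y0] := leP 0 (fine (c t)); last by rewrite mulr0 ltNge w0.
  case: (c t) y0 => [y||] /= y0; first by rewrite -EFinM lte_fin.
    by rewrite mulr0 ltNge w0.
  by rewrite mulr0 ltNge w0.
apply: (@le_trans _ _ (P n ([set t | u < Z t] `|` [set t | c t = +oo%E]))).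
  apply: le_measure; rewrite ?in_setE.
  - exact: measurable_scaled_tail.
  - exact: measurableU.
  move=> t /=; case E : (c t) => [y||]; [|by right|].
    rewrite -EFinM lte_fin => uy; left; rewrite /Z powR_inv_lt // E /=.
    by apply: lt_le_trans uy _; rewrite ler_pM2l // le_max lexx orbT.
  by rewrite gt0_muleNy ?lte_fin.
apply: le_trans (measureU2 _ mZu mU) _.
by rewrite [X in (_ + X)%E]prob_unmatched adde0.
Qed.

Let moment_Z n :
  ((n.+1%:R `^ (p / d))%:E * \int[P n]_t (c t `^ p))%E = (\int[P n]_t (Z t)%:E)%E.
Proof.
have mU := measurable_unmatched (@omega n) (v n).
have mcp : measurable_fun setT (fun t => (@c n t `^ p)%E).
  exact: (measurableT_comp (measurable_poweR p) (@measurable_cost n)).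
have mneg : measurable [set t | (@c n t < 0)%E].
  have := @measurable_cost n measurableT `]-oo, 0%E[%classic (emeasurable_itv _).
  by rewrite setTI; congr measurable; apply/seteqP; split => t /=; rewrite in_itv.
rewrite -ge0_integralZl //; first last.
- by move=> t _; exact: poweR_ge0.
apply: ge0_ae_eq_integral => //.
- exact: measurable_funeM.
- exact/measurable_EFinP.
- by move=> t _; rewrite mule_ge0 ?lee_fin ?powR_ge0 ?poweR_ge0.
- by move=> t _; rewrite lee_fin.
exists ([set t | (@c n t < 0)%E] `|` [set t | @c n t = +oo%E]); split.
- exact: measurableU.
- apply/eqP; rewrite eq_le measure_ge0 andbT.
  apply: le_trans (measureU2 _ mneg mU) _.
  by rewrite [X in (X + _)%E]prob_cost_lt0 [X in (_ + X)%E]prob_unmatched adde0.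
move=> t /= H; apply: contrapT => /not_orP[/negP + cy]; rewrite -leNgt => c0.
apply: H => _; rewrite /Z.
case: (c t) c0 cy => [y||] //= y0 _; rewrite -EFinM; congr EFin.
rewrite max_r // powRM ?(ltW (scale_gt0n n)) //; congr (_ * _).
by rewrite /scale -powRrM mulrC.
Qed.

(** The layer cake formula turns the moment into the integral of the tails, to
    which dominated convergence applies. *)
Lemma scaled_moment_cvg r : p < d -> 2 * d * p / (d - p) < r ->
  (\int[lebesgue_measure]_(y in `[0%R, +oo[) (y `^ r * rho y)%:E < +oo)%E ->
  (((n.+1%:R `^ (p / d))%:E * \int[P n]_t (c t `^ p)) @[n --> \oo] -->
    \int[lebesgue_measure]_(u in `[0%R, +oo[) ((1 + u `^ (d / p))^-1)%:E)%E.
Proof.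
move=> pd pr mom.
have [|C [b [C0 b1 H]]] := @scaled_tail_dominated p r _ pr mom; first by rewrite p_gt0.
rewrite (_ : (fun n => _) = (fun n =>
    \int[lebesgue_measure]_(u in `[0%R, +oo[) P n [set t | (u < Z t)%R])%E); last first.
  by apply/funext => n; rewrite moment_Z; exact: (integral_tail (P n) (@mZ n) (@Z_ge0 n)).1.
have [] // := @dominated_convergence _ _ _ lebesgue_measure (`[0%R, +oo[ : set R)
  (measurable_itv _) (fun n u => P n [set t | (u < Z t)%R])
  (fun u => ((1 + u `^ (d / p))^-1)%:E) (fun u => (C / (1 + u `^ b))%:E).
- by move=> n; apply: measurable_funTS; exact: (integral_tail (P n) (@mZ n) (@Z_ge0 n)).2.
- by apply/measurable_EFinP; exact: measurable_inv_powR.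
- apply/aeW => u /=; rewrite in_itv /= andbT => u0.
  under eq_fun do rewrite Z_tail //.
  by have := scaled_tail_cvg (powR_ge0 u p^-1); rewrite -powRrM [p^-1 * d]mulrC.
- apply/integrableP; split.
    apply/measurable_EFinP; apply: measurable_funM; first exact: measurable_cst.
    exact: measurable_inv_powR.
  apply: (@le_lt_trans _ _ (\int[lebesgue_measure]_(u in `[0%R, +oo[)
      (C%:E * ((1 + u `^ b)^-1)%:E))%E); last first.
    rewrite ge0_integralZl //.
    + by rewrite integral_inv_powR // -EFinM ltry.
    + by apply/measurable_EFinP; exact: measurable_inv_powR.
    + by move=> u _; rewrite lee_fin invr_ge0 addr_ge0 ?powR_ge0.
  rewrite le_eqVlt; apply/orP; left; apply/eqP/eq_integral => u _.
  by rewrite -EFinM gee0_abs // lee_fin divr_ge0 // addr_ge0 ?powR_ge0.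
- apply/aeW => u n /=; rewrite in_itv /= andbT => u0.
  rewrite gee0_abs ?measure_ge0 // Z_tail //.
  have := H n _ (powR_ge0 u p^-1); rewrite -powRrM mulrA mulVf ?gt_eqF // mul1r.
  exact.
Qed.

End moment.

End stable_cost_asymptotics.

(** * The limit law *)

Section limit_law.
Context (R : realType) disp (T : measurableType disp) (P : probability T R)
  (W : {RV P >-> R}).
Hypothesis W_ge0 : forall t, 0 <= W t.
Hypothesis W_law : forall x : R, 0 <= x -> P [set t | x <= W t] = ((1 + x)^-1)%:E.

Let mgt x : measurable [set t | x < W t].
Proof.
rewrite (_ : [set t | _] = W @^-1` `]x, +oo[).
  by rewrite -[X in measurable X]setTI; exact: measurable_funPT.
by apply/seteqP; split => t /=; rewrite in_itv /= andbT.
Qed.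

Let mge x : measurable [set t | x <= W t].
Proof.
rewrite (_ : [set t | _] = W @^-1` `[x, +oo[).
  by rewrite -[X in measurable X]setTI; exact: measurable_funPT.
by apply/seteqP; split => t /=; rewrite in_itv /= andbT.
Qed.

(** The law is given by non-strict inequalities; passing to strict ones uses the
    continuity of the right-hand side. *)
Lemma W_tail x : 0 <= x -> P [set t | x < W t] = ((1 + x)^-1)%:E.
Proof.
move=> x0; apply/eqP; rewrite eq_le; apply/andP; split.
  by rewrite -W_law //; apply: le_measure; rewrite ?in_setE // => t /ltW.
have Pfin : P [set t | x < W t] \is a fin_num by exact: fin_num_measure.
rewrite -(fineK Pfin) lee_fin; apply/ler_addgt0Pr => e e0.
have : (P [set t | (x + e <= W t)%R] <= P [set t | (x < W t)%R])%E.
  apply: le_measure; rewrite ?in_setE // => t /=; apply: lt_le_trans.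
  by rewrite ltrDl.
rewrite W_law; last by rewrite addr_ge0 // ltW.
rewrite -(fineK Pfin) lee_fin => H; rewrite -lerBlDr; apply: le_trans H.
have x1 : 0 < 1 + x by rewrite ltr_pwDl.
have xe : 0 < 1 + (x + e) by rewrite addrA addr_gt0.
rewrite lerBlDr -lerBlDl.
rewrite (_ : _ - _ = e / ((1 + x) * (1 + (x + e)))); last by field; rewrite !gt_eqF.
rewrite ler_pdivrMr ?mulr_gt0 // ler_peMr ?(ltW e0) // mulr_ege1 ?lerDl //.
by rewrite addr_ge0 // ltW.
Qed.

Lemma W_moment d p : 0 < p -> p < d ->
  ('E_P[(fun t => W t `^ (p / d))%R] =
   \int[lebesgue_measure]_(u in `[0%R, +oo[) ((1 + u `^ (d / p))^-1)%:E)%E.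
Proof.
move=> p0 pd; have d0 : 0 < d by exact: lt_trans pd.
rewrite unlock.
have mW : measurable_fun setT (fun t => W t `^ (p / d)).
  by apply: (measurableT_comp (measurable_powR _)); exact: measurable_funPT.
have [-> _] := integral_tail P mW (fun t => powR_ge0 _ _).
apply: eq_integral => u; rewrite inE /= in_itv /= andbT => u0.
rewrite -W_tail ?powR_ge0 //; congr (P _); apply/seteqP; split => t /=;
  by rewrite powR_inv_lt ?divr_gt0 // invf_div.
Qed.

End limit_law.

(* The n-th graph is K_{n+1,n+1}, so that every graph has a vertex. *)
Theorem theorem1p1 (R : realType) (d : R) (rho : R -> R)
  (disp : nat -> measure_display) (T : forall n, measurableType (disp n))
  (P : forall n, probability (T n) R)
  (omega : forall n, 'I_n.+1 * 'I_n.+1 -> {RV (P n) >-> R})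
  (v : forall n, 'I_n.+1)
  (dispW : measure_display) (TW : measurableType dispW)
  (PW : probability TW R) (W : {RV PW >-> R})
  (d_gt0 : 0 < d)
  (rho_density : is_density rho)
  (rho_near0 : rho x / (d * x `^ (d - 1)) @[x --> 0^'+] --> (1 : R))
  (omega_indep : forall n, mutually_independent (omega n))
  (omega_density : forall n e, has_density (omega n e) rho)
  (W_ge0 : forall t, 0 <= W t)
  (W_law : forall x : R, 0 <= x -> PW [set t | x <= W t] = ((1 + x)^-1)%:E) :
  let c := fun n (t : T n) =>
    stable_cost (fun u u' : 'I_n.+1 => omega n (u, u') t) (v n) in
  cvg_in_distribution P
    (fun n t => ((n.+1%:R `^ d^-1)%:E * c n t)%E)
    PW (fun t => W t `^ d^-1)
  /\
  (forall p : R, 0 < p < d ->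
     (exists2 r, 2 * d * p / (d - p) < r &
        (\int[lebesgue_measure]_(x in `[0%R, +oo[)
           (x `^ r * rho x)%:E < +oo)%E) ->
     ((n.+1%:R `^ (p / d))%:E * \int[P n]_t (c n t `^ p))%E @[n --> \oo]
       --> ('E_PW[(fun t => W t `^ (p / d))%R])%E
     /\
     ('E_PW[(fun t => W t `^ (p / d))%R])%E = (p * pi / (d * sin (p * pi / d)))%:E).
Proof.
move=> c.
have d_neq0 : d != 0 by rewrite gt_eqF.
have mY n z : measurable [set t | (z%:E < (n.+1%:R `^ d^-1)%:E * c n t)%E].
  exact: (@measurable_scaled_tail _ d _ _ P).
have cdfE n x : P n [set t | ((n.+1%:R `^ d^-1)%:E * c n t <= x%:E)%E] =
    (1 - scaled_tail d omega v n x)%E.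
  rewrite /scaled_tail -probability_setC; last exact: mY.
  by congr (P n _); apply/seteqP; split => t /=; rewrite leNgt => /negP.
have cdf_cvg x : 0 <= x -> P n [set t | ((n.+1%:R `^ d^-1)%:E * c n t <= x%:E)%E]
    @[n --> \oo] --> (1 - (1 + x `^ d)^-1)%:E.
  move=> x0; under eq_fun do rewrite cdfE.
  rewrite EFinB; apply: cvgeB => //; first exact: cvg_cst.
  exact: (scaled_tail_cvg v d_gt0 rho_density rho_near0 omega_indep omega_density x0).
split.
  move=> x _.
  have mWx y : measurable [set t | y < W t `^ d^-1].
    rewrite (_ : [set t | _] = (fun t => W t `^ d^-1) @^-1` `]y, +oo[); last first.
      by apply/seteqP; split => t /=; rewrite in_itv /= andbT.
    rewrite -[X in measurable X]setTI.
    apply: (measurableT_comp (measurable_powR _)) => //; exact: measurable_funPT.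
  have [x0|x0] := leP 0 x.
    rewrite (_ : PW _ = (1 - (1 + x `^ d)^-1)%:E); first exact: cdf_cvg.
    rewrite EFinB -(W_tail W_law) ?powR_ge0 //.
    have -> : [set t | x `^ d < W t] = [set t | x < W t `^ d^-1].
      by apply/seteqP; split => t /=; rewrite powR_inv_lt ?invr_gt0 // invrK.
    rewrite -probability_setC //; congr (PW _).
    by apply/seteqP; split => t /=; rewrite leNgt => /negP.
  rewrite (_ : PW _ = 0%E); last first.
    rewrite (_ : [set t | _] = set0) ?measure0 //; apply/seteqP; split => t //=.
    by rewrite leNgt (lt_le_trans x0) // powR_ge0.
  (* For [x < 0] compare with the value at 0, which tends to 0. *)
  have := cdf_cvg 0 (lexx 0); rewrite powR0 // addr0 invr1 subrr => H.
  apply: (@squeeze_cvge _ _ _ _ (fun=> 0%E) _ _ _ _ (cvg_cst _) H).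
  near=> n; rewrite measure_ge0 /=; apply: le_measure; rewrite ?in_setE.
  - rewrite (_ : [set t | _] = ~` [set t | (x%:E < (n.+1%:R `^ d^-1)%:E * c n t)%E]).
      exact: measurableC.
    by apply/seteqP; split => t /=; rewrite leNgt => /negP.
  - rewrite (_ : [set t | _] = ~` [set t | (0%:E < (n.+1%:R `^ d^-1)%:E * c n t)%E]).
      exact: measurableC.
    by apply/seteqP; split => t /=; rewrite leNgt => /negP.
  by move=> t /= /le_trans; apply; rewrite lee_fin ltW.
move=> p /andP[p0 pd] [r pr mom].
have dp : 1 < d / p by rewrite ltr_pdivlMr // mul1r.
rewrite (W_moment W_ge0 W_law p0 pd); split.
  exact: (scaled_moment_cvg v d_gt0 rho_density rho_near0 omega_indep omega_density p0 pd pr mom).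
rewrite integral_inv_powR //; congr EFin.
have -> : pi / (d / p) = p * pi / d by rewrite invf_div; ring.
by rewrite !invfM invrK; ring.
Unshelve. all: by end_near. Qed.
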